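(* Let $\lambda,\mu,\nu$ be partitions of lengths $m,p,q$, respectively, with $m\leq p+q$, and put $r=p+q$. Let $\mathbf{x}=(x_1,\ldots,x_r)$, $\mathbf{y}=(y_1,\ldots,y_p)$, $\mathbf{z}=(z_1,\ldots,z_q)$ be indeterminates and write $\overline{x}_i=x_i^{-1}$, $\overline{y}_i=y_i^{-1}$, $\overline{z}_i=z_i^{-1}$. Define $$K(\mathbf{x},\mathbf{y})=\prod_{i=1}^{r}\prod_{a=1}^{p}(1-x_iy_a)^{-1}(1-\overline{x}_iy_a)^{-1},\qquad K(\mathbf{x},\mathbf{z})=\prod_{i=1}^{r}\prod_{c=1}^{q}(1-x_iz_c)^{-1}(1-\overline{x}_iz_c)^{-1},$$ $$C(\overline{\mathbf{x}})=\prod_{1\leq i\leq j\leq r}(1-\overline{x}_i\overline{x}_j),\quad A(\mathbf{y})=\prod_{1\leq a<b\leq p}(1-y_ay_b),\quad A(\mathbf{z})=\prod_{1\leq c<d\leq q}(1-z_cz_d),$$ $$V(\mathbf{x})=\prod_{1\leq i<j\leq r}(1-\overline{x}_ix_j),\quad V(\mathbf{y})=\prod_{1\leq a<b\leq p}(1-\overline{y}_ay_b),\quad V(\mathbf{z})=\prod_{1\leq c<d\leq q}(1-\overline{z}_cz_d).$$ Then $$n_{\mu,\nu}^{\lambda}=[\mathbf{x}^{\lambda}\mathbf{y}^{\mu}\mathbf{z}^{\nu}]\;K(\mathbf{x},\mathbf{y})K(\mathbf{x},\mathbf{z})A(\mathbf{y})A(\mathbf{z})C(\overline{\mathbf{x}})V(\mathbf{x})V(\mathbf{y})V(\mathbf{z})$$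 and $$\sum_{t=0}^{\infty}n_{t\mu,t\nu}^{t\lambda}\,w^t=[\mathbf{x}^{0}\mathbf{y}^{0}\mathbf{z}^{0}]\;\frac{K(\mathbf{x},\mathbf{y})K(\mathbf{x},\mathbf{z})A(\mathbf{y})A(\mathbf{z})C(\overline{\mathbf{x}})V(\mathbf{x})V(\mathbf{y})V(\mathbf{z})}{1-w/(\mathbf{x}^{\lambda}\mathbf{y}^{\mu}\mathbf{z}^{\nu})}.$$
   Context: For partitions $\mu,\nu,\lambda$, let $c_{\mu,\nu}^{\lambda}$ be the Littlewood--Richardson coefficient, i.e. the coefficient of the Schur function $s_\lambda$ in $s_\mu s_\nu$. The Newell--Littlewood coefficient is $$n_{\mu,\nu}^{\lambda}=\sum_{\alpha,\beta,\gamma} c_{\alpha,\beta}^{\mu}\,c_{\alpha,\gamma}^{\nu}\,c_{\beta,\gamma}^{\lambda},$$ the sum being over all partitions $\alpha,\beta,\gamma$. The length of a partition is its number of nonzero parts; $t\kappa=(t\kappa_1,t\kappa_2,\ldots)$. $\mathbf{x}^\lambda=x_1^{\lambda_1}\cdots x_r^{\lambda_r}$ (with $\lambda$ padded by zeros to $r$ parts), $\mathbf{y}^\mu=y_1^{\mu_1}\cdots y_p^{\mu_p}$, $\mathbf{z}^\nu=z_1^{\nu_1}\cdots z_q^{\nu_q}$, and $[\mathbf{x}^{\lambda}\mathbf{y}^{\mu}\mathbf{z}^{\nu}](\cdots)$ denotes the coefficient of the monomial $\mathbf{x}^{\lambda}\mathbf{y}^{\mu}\mathbf{z}^{\nu}$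 in $(\cdots)$. Expansions: each factor $(1-x_i^{\pm1}y_a)^{-1}$, $(1-x_i^{\pm1}z_c)^{-1}$ is expanded as a geometric series in nonnegative powers of $y_a$, $z_c$ (so the coefficient of each monomial in $\mathbf{y},\mathbf{z}$ is a Laurent polynomial in $\mathbf{x}$), and $1/(1-w/Z)$ is expanded as $\sum_{t\geq0}w^tZ^{-t}$, the constant term in $\mathbf{x},\mathbf{y},\mathbf{z}$ being taken separately in each power of $w$. *)

(* Defs.v *)
From HB Require Import structures.
From mathcomp Require Import all_boot all_order all_algebra fraction finmap.
From mathcomp Require Import mpoly.
From mathcomp Require Import classical_sets fsbigop.

Set Implicit Arguments.
Unset Strict Implicit.
Unset Printing Implicit Defensive.

Import GRing.Theory.

Local Open Scope classical_set_scope.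
Local Open Scope ring_scope.

(* The parts are the nonzero ones, so [size la] is the length of [la]. *)
Definition is_intpart (s : seq nat) : bool := sorted geq s && (0%N \notin s).

Record intpart := IntPart { parts :> seq nat; _ : is_intpart parts }.

HB.instance Definition _ := [isSub for parts].
HB.instance Definition _ := [Choice of intpart by <:].

(* The filter only matters for [t = 0], where the result is empty. *)
Definition scale_seq (t : nat) (s : seq nat) : seq nat :=
  [seq k <- [seq (t * k)%N | k <- s] | k != 0%N].

Lemma scale_seqP t (la : intpart) : is_intpart (scale_seq t la).
Proof.
case: la => s /= /andP[s_sorted _]; apply/andP; split; last first.
  by rewrite mem_filter eqxx.
apply: sorted_filter => [y x z /= yx zy|]; first exact: leq_trans zy yx.
by apply: homo_sorted s_sorted => x y /= yx; rewrite leq_mul2l yx orbT.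
Qed.

Definition scale_part (t : nat) (la : intpart) : intpart :=
  IntPart (scale_seqP t la).

(* a_alpha = det (X_i ^ alpha_j) in Z[X_0, ..., X_(n-1)] *)
Definition alternant (n : nat) (alpha : 'I_n -> nat) : {mpoly int[n]} :=
  \det (\matrix_(i < n, j < n) 'X_i ^+ alpha j).

(* s_la(X_0, ..., X_(n-1)) = a_(la + rho) / a_rho with rho = (n-1, ..., 1, 0),
   and 0 if la has more than n parts. *)
Definition schur (n : nat) (la : intpart) : {fraction {mpoly int[n]}} :=
  if (size la <= n)%N then
    tofrac (alternant (fun j : 'I_n => nth 0%N la j + (n.-1 - j))%N)
    / tofrac (alternant (fun j : 'I_n => n.-1 - j)%N)
  else 0.

(* An identity of symmetric functions is an identity of symmetric polynomials
   in every number n of variables. *)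
Definition schur_expansion (f : forall n, {fraction {mpoly int[n]}})
    (c : {fsfun intpart -> int with 0}) : Prop :=
  forall n, f n = \sum_(la <- finsupp c) schur n la *~ c la.

(* Schur functions form a basis of the ring of symmetric functions, hence there
   is exactly one such finitely supported c when f is symmetric; the first
   argument of [xget] is the value for an f without expansion. *)
Definition schur_coef (f : forall n, {fraction {mpoly int[n]}})
    (la : intpart) : int :=
  (xget [fsfun] [set c | schur_expansion f c]) la.

Definition LR (mu nu la : intpart) : int :=
  schur_coef (fun n => schur n mu * schur n nu) la.

(* [\sum_(_ \in _)] is the sum of a finitely supported family (0 otherwise). *)
Definition NL (mu nu la : intpart) : int :=
  \sum_(abc \in [set: intpart * intpart * intpart])
    (let: (alpha, beta, gamma) := abc in
     LR alpha beta mu * LR alpha gamma nu * LR beta gamma la).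

(* Formal integer combinations of Laurent monomials, the monomials being
   written additively: [f d] is the coefficient of the monomial of exponent d *)
Definition series (E : zmodType) : Type := E -> int.

Section Series.

Variable E : zmodType.
Implicit Types (e d : E) (f g : series E).

Definition smono e : series E := fun d => (d == e)%:R.

(* For the products below this sum is finite: all the series involved have
   y- and z-exponents bounded below, and finitely many x-exponents for given y-
   and z-exponents. *)
Definition smul f g : series E :=
  fun d => \sum_(e \in [set: E]) f e * g (d - e).

(* 1 - X^e *)
Definition one_minus e : series E := fun d => smono 0 d - smono e d.

(* (1 - X^e)^-1 = sum_t X^(t e), for e not a torsion element *)
Definition geom e : series E := fun d => \sum_(t \in [set: nat]) smono (e *+ t) d.

(* Power series in w over [series E], and their constant term in the variables
   of E, taken in each power of w *)
Definition wseries : Type := nat -> series E.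

(* 1 / (1 - w X^e) *)
Definition wgeom e : wseries := fun t => smono (e *+ t).

Definition wscale f (g : wseries) : wseries := fun t => smul f (g t).

Definition wconst_term (g : wseries) : nat -> int := fun t => g t 0.

End Series.

Declare Scope series_scope.
Delimit Scope series_scope with series.
Notation "f * g" := (smul f g) : series_scope.
Notation "\prod_ ( i < n ) F" := (\big[@smul _/smono 0]_(i < n) F%series)
  : series_scope.
Notation "\prod_ ( i < n | P ) F" :=
  (\big[@smul _/smono 0]_(i < n | P) F%series) : series_scope.

Definition expo (r p q : nat) : zmodType :=
  ('rV[int]_r * 'rV[int]_p * 'rV[int]_q)%type.

Section Kernel.
Variables r p q : nat.

Definition xv (i : 'I_r) : expo r p q := (delta_mx 0 i, 0, 0).
Definition yv (a : 'I_p) : expo r p q := (0, delta_mx 0 a, 0).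
Definition zv (c : 'I_q) : expo r p q := (0, 0, delta_mx 0 c).

Local Open Scope series_scope.

Definition kernelK (n : nat) (u : 'I_n -> expo r p q) : series (expo r p q) :=
  \prod_(i < r) \prod_(a < n)
    (geom (xv i + u a)%R * geom (- xv i + u a)%R).

Definition factorC : series (expo r p q) :=
  \prod_(i < r) \prod_(j < r | (i <= j)%N) one_minus (- xv i - xv j)%R.

Definition factorA (n : nat) (u : 'I_n -> expo r p q) : series (expo r p q) :=
  \prod_(a < n) \prod_(b < n | (a < b)%N) one_minus (u a + u b)%R.

Definition factorV (n : nat) (u : 'I_n -> expo r p q) : series (expo r p q) :=
  \prod_(a < n) \prod_(b < n | (a < b)%N) one_minus (- u a + u b)%R.

Definition integrand : series (expo r p q) :=
  kernelK yv * kernelK zv * factorA yv * factorA zv * factorC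
    * factorV xv * factorV yv * factorV zv.

Definition part_row (n : nat) (s : seq nat) : 'rV[int]_n :=
  \row_(i < n) (nth 0%N s i)%:Z.

(* the exponent of x^la y^mu z^nu *)
Definition part_expo (la mu nu : seq nat) : expo r p q :=
  (part_row r la, part_row p mu, part_row q nu).

End Kernel.

Arguments integrand : clear implicits.

(* Main.v *)
Require Import Defs.
From HB Require Import structures.
From mathcomp Require Import all_boot all_order all_fingroup all_algebra fraction finmap.
From mathcomp Require Import mpoly ring zify.
From mathcomp Require Import boolp classical_sets fsbigop.

(** Let u = (y, z), which has r entries, as x has. Cauchy's determinant in the
    variables x_i + 1/x_i turns K(x,u) A(u) C(1/x) V(x), times the Vandermonde
    product of u, into the determinant of the entries
    1 / (1 - x_i u_j) - x_i^-2 / (1 - u_j / x_i), up to a monomial. Only the first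
    term contributes nonnegative exponents of x_i, so Cauchy's determinant in x
    shows that this kernel and V(x) prod 1 / (1 - x_i u_j) have the same
    coefficients at the monomials x^la. As A(u) = A(y) A(z) prod (1 - y_a z_c),
    the integrand may be replaced by
    V(x) V(y) V(z) prod 1/(1 - x_i y_a) prod 1/(1 - x_i z_c) prod 1/(1 - y_a z_c).
    The Cauchy identity writes the three products as sums of s_be(x) s_be(y),
    s_ga(x) s_ga(z) and s_al(y) s_al(z). Extracting a coefficient of V times a
    product of two Schur polynomials gives a Littlewood-Richardson coefficient,
    so the result is the sum defining n. *)

Set Implicit Arguments.
Unset Strict Implicit.
Unset Printing Implicit Defensive.

Import Order.TTheory GRing.Theory Num.Theory.

Local Open Scope ring_scope.

(** The product [smul] is meaningful only for compatible supports, so the argument needs a ring that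
    contains every factor of the integrand. This ring is [gser D]: the grading is the total degree
    in y and z, all degrees are nonnegative, and only finitely many exponents lie below each bound.
    Factors 1 - u_j / u_i have degree 0 and no geometric inverse there, so the Vandermonde product
    of u is cancelled by a finiteness argument; that of x stays, since V(x) supplies it. The
    infinite Cauchy sums become congruences modulo high degree. Schur polynomials have to be
    evaluated at monomials of this ring, where a quotient of alternants makes no sense. They are
    therefore defined by Jacobi-Trudi determinants, which exist over every commutative ring. [LR]
    refers to an expansion valid in all numbers of variables at once. Homogeneity and stability
    under adding variables produce one, and identify its coefficients with those of x^(la + rho) in
    s_mu s_nu a_rho. *)

(** * Complete symmetric functions of a list *)

Section CompleteSymmetric.

Variable R : comNzRingType.
Implicit Types (s t : seq R) (u v : R).

Fixpoint hsym s : nat -> R :=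
  if s is u :: s' then
    fix hu k := hsym s' k + (if k is k'.+1 then u * hu k' else 0)
  else fun k => (k == 0%N)%:R.

Lemma hsym_cons0 u s : hsym (u :: s) 0 = hsym s 0.
Proof. by rewrite /= addr0. Qed.

Lemma hsym_consS u s k : hsym (u :: s) k.+1 = hsym s k.+1 + u * hsym (u :: s) k.
Proof. by []. Qed.

Lemma hsym0 s : hsym s 0 = 1.
Proof. by elim: s => // u s IHs; rewrite hsym_cons0. Qed.

Lemma eq_hsym_cons u s t : hsym s =1 hsym t -> hsym (u :: s) =1 hsym (u :: t).
Proof.
by move=> est; elim=> [|k IHk]; rewrite ?hsym_cons0 ?hsym_consS est ?IHk.
Qed.

(** Two applications of the recursion give an expression symmetric in [u] and [v], once the two
    preceding degrees are known to be symmetric; hence the strong induction. *)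
Lemma hsym_swap u v s : hsym (u :: v :: s) =1 hsym (v :: u :: s).
Proof.
elim/ltn_ind=> -[|[|k]] IHk; rewrite ?hsym_cons0 //.
  by rewrite !hsym_consS !hsym0; ring.
have IHk1 := IHk k.+1 (ltnSn _); have IHk0 := IHk k (leqnSn _).
rewrite !(hsym_consS _ (_ :: _) k.+1) !(hsym_consS _ s k.+1).
have Eu := hsym_consS u (v :: s) k; have Ev := hsym_consS v (u :: s) k.
rewrite IHk1 IHk0 in Eu *.
have {}Eu : hsym (v :: s) k.+1
    = hsym (v :: u :: s) k.+1 - u * hsym (v :: u :: s) k by rewrite Eu addrK.
by rewrite Eu Ev; ring.
Qed.

Lemma hsym_mid u s t : hsym (s ++ u :: t) =1 hsym (u :: s ++ t).
Proof.
elim: s => // v s IHs k.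
by rewrite -[LHS]/(hsym (v :: _) k) (eq_hsym_cons v IHs) hsym_swap.
Qed.

Lemma hsym_cat_nseq0 s k : hsym (s ++ nseq k 0) =1 hsym s.
Proof.
elim: s => [|u s IHs]; last exact: (eq_hsym_cons u IHs).
elim: k => //= k IHk [|l]; first by rewrite /= IHk addr0.
by rewrite /= IHk mul0r addr0.
Qed.

(** The generating function H(X), truncated below degree [L]; [egen] is E(-X), the inverse of the
    full series. *)
Definition hgen s L : {poly R} := \poly_(k < L) hsym s k.

Definition egen s : {poly R} := \prod_(v <- s) (1 - v%:P * 'X).

Lemma size_egen s : (size (egen s) <= (size s).+1)%N.
Proof.
rewrite /egen; elim: s => [|v s IHs]; first by rewrite big_nil size_poly1.
rewrite big_cons; apply: leq_trans (size_polyMleq _ _) _.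
have : (size (1 - v%:P * 'X : {poly R})%R <= 2)%N.
  apply: leq_trans (size_polyD _ _) _; rewrite geq_max size_poly1 /= size_polyN.
  by rewrite mul_polyC; apply: leq_trans (size_scale_leq _ _) _; rewrite size_polyX.
by move: IHs => /=; lia.
Qed.

Lemma coef0_egen s : (egen s)`_0 = 1.
Proof.
rewrite /egen; elim: s => [|v s IHs]; first by rewrite big_nil coefC.
by rewrite big_cons coef0M IHs coefB coefC coefMX subr0 mulr1.
Qed.

Lemma coef_hgen_cons v s L a : (a < L)%N ->
  ((1 - v%:P * 'X) * hgen (v :: s) L)`_a = hsym s a.
Proof.
move=> ltaL; rewrite mulrBl mul1r coefB -mulrA coefCM coefXM !coef_poly ltaL.
case: a ltaL => [|a] ltaL; first by rewrite mulr0 subr0 !hsym0.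
by rewrite (ltnW ltaL) hsym_consS addrK.
Qed.

Lemma coef_egen_hgen s t L a : (a < L)%N ->
  (egen s * hgen (s ++ t) L)`_a = hsym t a.
Proof.
rewrite /egen; elim: s a => [|v s IHs] a ltaL.
  by rewrite big_nil mul1r coef_poly ltaL.
rewrite big_cons mulrAC mulrC -IHs // !coefM; apply: eq_bigr => i _.
have ltiL : (a - i < L)%N by lia.
by rewrite mulrC [in RHS]mulrC [X in _ = X * _]coef_poly ltiL coef_hgen_cons // mulrC.
Qed.

(** The guard gives h of a negative index the value 0, where truncated subtraction would give
    h_0. *)
Definition hsym_sub s a b : R := if (b <= a)%N then hsym s (a - b) else 0.

(* The coefficients of [egen t] are signed elementary symmetric functions, so
   this is the identity H(X) E(-X) = 1 with the variables of [t] removed. *)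
Lemma sum_egen_hsym_sub t s a n : (size t < n)%N ->
  \sum_(b < n) (egen t)`_b * hsym_sub (t ++ s) a b = hsym s a.
Proof.
move=> lttn; rewrite -(@coef_egen_hgen t s a.+1 a) // coefM.
pose F b := (egen t)`_b * hsym_sub (t ++ s) a b.
have EF : \sum_(b < a.+1) F b = \sum_(i < a.+1) (egen t)`_i * (hgen (t ++ s) a.+1)`_(a - i).
  apply: eq_bigr => i _; rewrite /F /hsym_sub coef_poly ltnS leq_subr.
  by rewrite -ltnS ltn_ord.
have F0l b : (n <= b)%N -> F b = 0.
  move=> lenb; rewrite /F nth_default ?mul0r //.
  exact: leq_trans (size_egen t) (leq_trans lttn lenb).
have F0r b : (a.+1 <= b)%N -> F b = 0.
  by move=> leab; rewrite /F /hsym_sub leqNgt leab mulr0.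
(* The two ranges of summation are compared inside a common larger one: the terms vanish beyond the
   degree of [egen t] and beyond [a]. *)
have widen m : (m <= n + a.+1)%N -> (forall b, (m <= b)%N -> F b = 0) ->
    \sum_(b < m) F b = \sum_(b < n + a.+1) F b.
  move=> lem F0; rewrite -!(big_mkord xpredT F) [RHS](big_cat_nat (leq0n m) lem) /=.
  rewrite [X in _ + X]big_nat_cond [X in _ + X]big1 ?addr0 // => i.
  by case/andP=> /andP[/F0].
by rewrite -EF (widen n) ?(widen a.+1) ?leq_addr ?leq_addl.
Qed.

End CompleteSymmetric.

(* The parts of la + rho, where rho = (n-1, ..., 1, 0). *)
Definition shifted (n : nat) (la : seq nat) (j : nat) : nat :=
  (nth 0 la j + (n.-1 - j))%N.

(** * Jacobi-Trudi determinants and alternants *)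

Section JacobiTrudi.

Variable R : comNzRingType.
Implicit Types (s : seq R) (la : seq nat).

Definition alt n (u : 'I_n -> R) (f : 'I_n -> nat) : R :=
  \det (\matrix_(i < n, j < n) u i ^+ f j).

(** The Jacobi-Trudi determinant det (h_(la_i - i + j)), with n - 1 added to both parts of the index
    to stay within the natural numbers. *)
Definition jt n s la : R :=
  \det (\matrix_(i < n, j < n) hsym_sub s (shifted n la i) (n.-1 - j)).

Lemma hsym_sub0 s a b : (a < b)%N -> hsym_sub s a b = 0.
Proof. by rewrite /hsym_sub ltnNge => /negbTE->. Qed.

Lemma hsym_subn s a : hsym_sub s a a = 1.
Proof. by rewrite /hsym_sub leqnn subnn hsym0. Qed.

Lemma eq_jt n s t la : hsym s =1 hsym t -> jt n s la = jt n t la.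
Proof.
move=> est; congr (\det _); apply/matrixP => i j.
by rewrite !mxE /hsym_sub est.
Qed.

Lemma jt_nil n s : jt n s [::] = 1.
Proof.
rewrite /jt -det_tr det_trig.
  by rewrite big1 // => i _; rewrite !mxE /shifted nth_nil hsym_subn.
apply/is_trig_mxP => i j ltij; rewrite !mxE /shifted nth_nil hsym_sub0 //.
by case: n i j ltij => [|n] [i lti] [j ltj] //=; lia.
Qed.

Lemma sum_rev n (F : nat -> R) : \sum_(b < n) F (n.-1 - b)%N = \sum_(b < n) F b.
Proof.
rewrite [RHS](reindex_inj rev_ord_inj) /=; apply: eq_bigr => i _.
by rewrite -subn1 -subnDA add1n.
Qed.

(** If the c_b are the coefficients of E(-X) for the variables other than u_i, then u_i^a is the sum
    of the c_b h_(a - b)(u). So the alternant matrix is a factor independent of [la] times the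
    transposed Jacobi-Trudi matrix, and the empty partition identifies the determinant of that
    factor. No division occurs. *)
Lemma alt_jt n (u : 'I_n -> R) la :
  alt u (shifted n la) = jt n (codom u) la * alt u (shifted n [::]).
Proof.
have /fin_all_exists [C hC] (i : 'I_n) : exists c : nat -> R,
    forall a, \sum_(b < n) c b * hsym_sub (codom u) a b = u i ^+ a.
  have : u i \in codom u by apply: codom_f.
  have := size_codom u; rewrite card_ord.
  move: (codom u) => s ss /path.splitPr su.
  case: su ss => s1 s2; rewrite size_cat /= addnS => ss.
  exists (fun b => (egen (s1 ++ s2))`_b) => a.
  (* Removing all variables but u_i leaves h_a(u_i) = u_i^a. *)
  transitivity (hsym [:: u i] a); last first.
    elim: a => [|a IHa]; first by rewrite hsym0 expr0.
    by rewrite hsym_consS IHa add0r exprS.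
  rewrite -(@sum_egen_hsym_sub _ (s1 ++ s2) _ a n); last by rewrite size_cat -ss.
  apply: eq_bigr => b _; congr (_ * _); rewrite /hsym_sub; case: ifP => // _.
  by rewrite !hsym_mid cats0.
have altE ka : alt u (shifted n ka) = \det (\matrix_(i < n, j < n) C i (n.-1 - j)%N)
                                     * jt n (codom u) ka.
  rewrite -[jt _ _ _]det_tr -det_mulmx; congr (\det _); apply/matrixP => i j.
  rewrite !mxE -hC -(sum_rev n (fun b => C i b * hsym_sub _ _ b)).
  by apply: eq_bigr => b _; rewrite !mxE.
by rewrite !altE jt_nil mulr1 mulrC.
Qed.

(** The last row of the larger matrix is (0, ..., 0, 1), because [la] has no part at that index. *)
Lemma jtS n s la : (size la <= n)%N -> jt n.+1 s la = jt n s la.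
Proof.
move=> lela; rewrite /jt (expand_det_row _ ord_max) (bigD1 ord_max) //= big1.
  rewrite addr0 !mxE /shifted nth_default // add0n subnn hsym_subn mul1r.
  rewrite /cofactor /= addnn -signr_odd odd_double mul1r; congr (\det _).
  apply/matrixP => i j; rewrite !mxE !lift_max /hsym_sub /=.
  have lti := ltn_ord i; have ltj := ltn_ord j.
  have -> : ((n - j <= nth 0 la i + (n - i)) = (n.-1 - j <= nth 0 la i + (n.-1 - i)))%N.
    by lia.
  have -> : (nth 0 la i + (n - i) - (n - j) = nth 0 la i + (n.-1 - i) - (n.-1 - j))%N.
    by lia.
  by [].
move=> j; rewrite -val_eqE /= => neqj; rewrite !mxE /shifted nth_default //.
rewrite add0n subnn hsym_sub0 ?mul0r //=; have := ltn_ord j; lia.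
Qed.

Lemma jt_stable n s la : (size la <= n)%N -> jt n s la = jt (size la) s la.
Proof.
move=> /subnK <-; elim: (n - _)%N => // k IHk.
by rewrite addSn jtS ?leq_addl.
Qed.

(** The coefficients of E(-X) for [s] form a kernel vector: each row yields h_k of the empty list,
    with k > 0 as all parts are nonzero. One entry of the vector is 1, so the adjugate gives
    determinant 0 even in the presence of zero divisors. *)
Lemma jt_eq0 n s la : 0%N \notin la -> (size s < size la <= n)%N -> jt n s la = 0.
Proof.
move=> la0 /andP[ltsla /jt_stable->].
pose c : 'cV[R]_(size la) := \col_j (egen s)`_((size la).-1 - j).
pose A := \matrix_(i < size la, j < size la)
  hsym_sub s (shifted (size la) la i) ((size la).-1 - j).
have Ac0 : A *m c = 0.
  apply/matrixP => i j; rewrite !mxE.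
  transitivity (hsym [::] (shifted (size la) la i) : R).
    rewrite -(@sum_egen_hsym_sub _ s _ _ _ ltsla) cats0.
    rewrite -(sum_rev _ (fun b => (egen s)`_b * hsym_sub s _ b)).
    by apply: eq_bigr => b _; rewrite !mxE mulrC.
  have : nth 0%N la i != 0%N by apply: contraNneq la0 => <-; rewrite mem_nth.
  by rewrite /shifted /=; case: (nth _ _ _).
have lastP : ((size la).-1 < size la)%N by case: (size la) ltsla.
have := congr1 (fun M : 'cV_(size la) => M (Ordinal lastP) 0) (mulmxA (\adj A) A c).
rewrite Ac0 mulmx0 mul_adj_mx mul_scalar_mx !mxE subnn coef0_egen mulr1.
by move=> /esym.
Qed.

End JacobiTrudi.

(** * Compatibility with ring morphisms *)

Section Naturality.

Variables (R S : comNzRingType) (f : {rmorphism R -> S}).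

Lemma hsym_map s k : hsym (map f s) k = f (hsym s k).
Proof.
elim: s k => [|u s IHs] k; first by rewrite /= rmorph_nat.
elim: k => [|k IHk]; first by rewrite map_cons !hsym_cons0 IHs.
by rewrite map_cons !hsym_consS rmorphD rmorphM /= -IHs -IHk.
Qed.

Lemma jt_map n s la : jt n (map f s) la = f (jt n s la).
Proof.
rewrite /jt -det_map_mx; congr (\det _); apply/matrixP => i j.
by rewrite !mxE /hsym_sub; case: ifP; rewrite ?rmorph0 // hsym_map.
Qed.

Lemma alt_map n (u : 'I_n -> R) a : alt (f \o u) a = f (alt u a).
Proof.
rewrite /alt -det_map_mx; congr (\det _); apply/matrixP => i j.
by rewrite !mxE rmorphXn.
Qed.

End Naturality.

(** * Schur polynomials over a commutative ring *)

Section SchurPoly.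

Variable R : comNzRingType.
Implicit Types (s : seq R) (la : intpart).

Definition spoly s (la : seq nat) : R := jt (size la) s la.

Lemma intpart_neq0 la : 0%N \notin (la : seq nat).
Proof. by case: la => la /= /andP[]. Qed.

Lemma intpart_sorted la : sorted geq la.
Proof. by case: la => la /= /andP[]. Qed.

Lemma spoly_jt n s la : (size la <= n)%N -> jt n s la = spoly s la.
Proof. exact: jt_stable. Qed.

Lemma spoly_eq0 s la : (size s < size la)%N -> spoly s la = 0.
Proof. by move=> lts; apply: jt_eq0; rewrite ?intpart_neq0 ?lts /=. Qed.

Lemma spoly_cat_nseq0 s k la : spoly (s ++ nseq k 0) la = spoly s la.
Proof. exact/eq_jt/hsym_cat_nseq0. Qed.

Lemma alt_spoly n (u : 'I_n -> R) la : (size la <= n)%N ->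
  alt u (shifted n la) = spoly (codom u) la * alt u (shifted n [::]).
Proof. by move=> ?; rewrite alt_jt spoly_jt. Qed.

End SchurPoly.

Lemma spoly_map (R S : comNzRingType) (f : {rmorphism R -> S}) s la :
  spoly (map f s) la = f (spoly s la).
Proof. exact: jt_map. Qed.

Lemma eq_intpart (la ka : intpart) :
  (forall j, nth 0%N la j = nth 0%N ka j) -> la = ka.
Proof.
move=> eqn; apply: val_inj; apply: (@eq_from_nth _ 0%N) => //=.
wlog lt : la ka eqn / (size la < size ka)%N => [hw|].
  by case: (ltngtP (size la) (size ka)) => // lt; [|apply/esym]; apply: hw.
have := intpart_neq0 ka; rewrite -[in X in X -> _](nth_default 0%N (leqnn (size la))).
by rewrite eqn mem_nth.
Qed.

Lemma nth_filter_neq0 (w : seq nat) j : sorted geq w ->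
  nth 0%N [seq k <- w | k != 0%N] j = nth 0%N w j.
Proof.
elim: w j => //= x w IHw j sw; have {}IHw := IHw _ (path_sorted sw).
case: eqP => [x0|_]; last by case: j => //= j.
have w0 : all (pred1 0%N) w.
  have /allP tw : all (geq x) w by apply: order_path_min sw => a b c /= ? ?; lia.
  by apply/allP => y /tw /=; rewrite x0 leqn0.
have -> : [seq k <- w | k != 0%N] = [::].
  by apply/eqP; rewrite -[_ == _]negbK -has_filter; apply/hasPn => y /(allP w0)/= ->.
case: j => [|j] /=; first by rewrite x0.
have [ltj|lej] := ltnP j (size w); last by rewrite nth_default.
by have /eqP-> := all_nthP 0%N w0 j ltj.
Qed.

(** * Alternating polynomials and strictly decreasing exponents *)

Section Alternating.

Variables (R : comNzRingType) (n : nat).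
Implicit Types (g : {mpoly R[n]}) (la ka : intpart) (m : 'X_{1..n}).

Definition mvar (i : 'I_n) : {mpoly R[n]} := 'X_i.

Definition mshifted (la : seq nat) : 'X_{1..n} := [multinom shifted n la j | j < n].

Definition alternating g := forall s : 'S_n, msym s g = (-1) ^+ s * g.

Definition strictly_decreasing (f : 'I_n -> nat) :=
  forall i j : 'I_n, (i < j)%N -> (f j < f i)%N.

Lemma shifted_decr la : strictly_decreasing (shifted n la).
Proof.
move=> i j ltij; rewrite /shifted.
have : (nth 0 la j <= nth 0 la i)%N.
  have [ltj|] := ltnP j (size la); last by move=> lej; rewrite nth_default.
  have := sorted_ltn_nth _ 0%N (intpart_sorted la); apply; rewrite ?inE //.
    by move=> a b c /= ? ?; lia.
  exact: ltn_trans ltij ltj.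
by have := ltn_ord j; lia.
Qed.

Lemma mshifted_inj la ka : (size la <= n)%N -> (size ka <= n)%N ->
  mshifted la = mshifted ka -> la = ka.
Proof.
move=> lela leka eqm; apply: eq_intpart => j.
have [ltj|lej] := ltnP j n; last by rewrite !nth_default //; lia.
by have /mnmP/(_ (Ordinal ltj)) := eqm; rewrite !mnmE /shifted /=; lia.
Qed.

(** An increasing [t] satisfies i <= t i; this is applied to [s] and to its inverse. *)
Lemma increasing_perm (s : 'S_n) :
  (forall i j : 'I_n, (i < j)%N -> (s i < s j)%N) -> s = 1%g.
Proof.
have le_incr (t : 'S_n) (i : 'I_n) :
    (forall i j : 'I_n, (i < j)%N -> (t i < t j)%N) -> (i <= t i)%N.
  move=> tP; case: i => k; elim: k => //= k IHk ltk.
  have ltk' := ltnW ltk; apply: leq_ltn_trans (IHk ltk') _.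
  exact: tP.
move=> sP; apply/permP => i; rewrite perm1; apply/val_inj/eqP => /=.
rewrite eqn_leq le_incr // andbT -{2}(permK s i); apply: le_incr => a b ltab.
rewrite ltnNge leq_eqVlt; apply/negP => /orP[/eqP/val_inj/perm_inj eab|].
  by rewrite eab ltnn in ltab.
by move/sP; rewrite !permKV; lia.
Qed.

Lemma alt_mvar f :
  alt mvar f = \sum_(s : 'S_n) (-1) ^+ s * 'X_[[multinom f (s i) | i < n]].
Proof.
apply: eq_bigr => s _; congr (_ * _); rewrite mpolyXE_id.
by apply: eq_bigr => i _; rewrite !mxE mnmE.
Qed.

Lemma mcoeff_signM (b : bool) (g : {mpoly R[n]}) m : ((-1) ^+ b * g)@_m = (-1) ^+ b * g@_m.
Proof. by rewrite !mulr_sign; case: b; rewrite ?mcoeffN. Qed.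

(** Only the identity permutation takes a strictly decreasing exponent to a strictly decreasing
    one. *)
Lemma mcoeff_alt f m : strictly_decreasing f -> strictly_decreasing m ->
  (alt mvar f)@_m = (m == [multinom f i | i < n])%:R.
Proof.
move=> fP mP; rewrite alt_mvar raddf_sum /= (bigD1 1%g) //= big1 ?addr0.
  rewrite mcoeff_signM mcoeffX odd_perm1 mul1r eq_sym; congr (_ == _)%:R.
  by apply/mnmP => i; rewrite !mnmE perm1.
move=> s s_neq1; rewrite mcoeff_signM mcoeffX.
case: eqP => [em|]; rewrite ?mulr0 //; case/eqP: s_neq1.
apply: increasing_perm => i j ltij; have := mP i j ltij; rewrite -em !mnmE.
move=> ltf; rewrite ltnNge leq_eqVlt; apply/negP => /orP[/eqP/val_inj eab|/fP].
  by rewrite eab ltnn in ltf.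
by lia.
Qed.

Lemma alternating_alt f : alternating (alt mvar f).
Proof.
move=> s; rewrite -[LHS]alt_map /alt -det_perm -det_mulmx -row_permE.
by congr (\det _); apply/matrixP => i j; rewrite !mxE /= msymX; congr (_ ^+ _);
  congr 'X_[_]; apply/mnmP => k; rewrite !mnmE /= -(inj_eq (@perm_inj _ s)) permKV.
Qed.

End Alternating.

(** * Expansion of alternating polynomials in alternants *)

Section AlternatingExpansion.

Variables (R : comNzRingType) (n : nat).
Implicit Types (g : {mpoly R[n]}) (la : intpart) (m : 'X_{1..n}).

(** Satisfied by the integers, for products of Schur polynomials, and by [gser D], for the Cauchy
    identity. *)
Hypothesis R_no2 : forall x : R, x = - x -> x = 0.

Lemma sort_mnm m :
  exists s : 'S_n, forall i j : 'I_n, (i <= j)%N -> (m (s j) <= m (s i))%N.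
Proof.
have geq_total : total geq by move=> a b /=; case: leqP => // /ltnW.
have geq_trans : transitive geq by move=> a b c /= ? ?; lia.
have /tuple_permP [s es] : perm_eq (sort geq [tuple m i | i < n]) [tuple m i | i < n].
  by rewrite perm_sort.
exists s => i j leij.
have nthE (k : 'I_n) : nth 0%N (sort geq [tuple m i | i < n]) k = m (s k).
  by rewrite es -tnth_nth !tnth_mktuple.
rewrite -!nthE; have := sorted_leq_nth geq_trans _ 0%N (sort_sorted geq_total _).
by apply; rewrite ?inE ?size_sort ?size_tuple // => a /=.
Qed.

(** At an exponent with two equal entries the coefficient is its own negative. Any other exponent
    can be sorted, which changes the coefficient only by a sign. *)
Lemma alternating_eq0 g : alternating g ->
  (forall m, strictly_decreasing m -> g@_m = 0) -> g = 0.
Proof.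
move=> gP g0; apply/mpolyP => m; rewrite mcoeff0.
have gsE (s : 'S_n) : g@_[multinom m (s i) | i < n] = (-1) ^+ s * g@_m.
  by rewrite -mcoeff_sym gP mcoeff_signM.
have [/existsP[i /existsP[j /andP[neqij /eqP emij]]]|inj_m] :=
  boolP [exists i, exists j, (i != j) && (m i == m j)].
  apply: R_no2; have := gsE (tperm i j); rewrite odd_tperm neqij mulN1r => <-.
  by congr (g@__); apply/mnmP => k; rewrite mnmE; case: tpermP => [->|->|].
have [s sP] := sort_mnm m.
have : g@_[multinom m (s i) | i < n] = 0.
  apply: g0 => i j ltij; rewrite !mnmE ltn_neqAle sP ?andbT 1?ltnW //.
  apply: contra inj_m => /eqP emij; apply/existsP; exists (s i).
  apply/existsP; exists (s j); rewrite emij eqxx andbT (inj_eq perm_inj).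
  by rewrite -val_eqE ltn_eqF.
by rewrite gsE mulr_sign; case: ifP => // _ /eqP; rewrite oppr_eq0 => /eqP.
Qed.

Lemma ex_mshifted m : strictly_decreasing m ->
  exists2 la : intpart, (size la <= n)%N & m = mshifted n la.
Proof.
move=> mP.
(* Consecutive entries differ by at least 1, so m - rho is weakly decreasing and the truncated
   subtraction in [w] is exact. *)
have mD (i j : 'I_n) : (i <= j)%N -> (m j + (j - i) <= m i)%N.
  case: j => j; elim: j => [|j IHj] ltj /= leij.
    by rewrite leqn0 in leij; have /eqP-> : i == Ordinal ltj by []; lia.
  move: leij; rewrite leq_eqVlt => /orP[/eqP eij|ltij].
    have -> : i = Ordinal ltj by apply: val_inj.
    by rewrite subnn addn0.
  have := IHj (ltnW ltj) ltij; have := mP (Ordinal (ltnW ltj)) (Ordinal ltj) (ltnSn _).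
  by move=> /=; lia.
pose w := [seq (m i - (n.-1 - i))%N | i <- enum 'I_n].
have nthw (i : 'I_n) : nth 0%N w i = (m i - (n.-1 - i))%N.
  by rewrite (nth_map i) ?size_enum_ord ?ltn_ord // nth_ord_enum.
have sw : sorted geq w.
  apply/(sortedP 0%N) => i; rewrite size_map size_enum_ord => lti.
  have := nthw (Ordinal lti); have := nthw (Ordinal (ltnW lti)) => /= -> ->.
  by have := mD (Ordinal (ltnW lti)) (Ordinal lti) (leqnSn _) => /=; lia.
have la_part : is_intpart [seq k <- w | k != 0%N].
  rewrite /is_intpart mem_filter eqxx andbT; apply: sorted_filter sw.
  by move=> a b c /= ? ?; lia.
exists (IntPart la_part).
  rewrite /= size_filter -[X in (_ <= X)%N](size_enum_ord n).
  by rewrite -(size_map (fun i : 'I_n => m i - (n.-1 - i))%N) count_size.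
apply/mnmP => i; rewrite mnmE /shifted /= nth_filter_neq0 // nthw.
have lastP : (n.-1 < n)%N by have := ltn_ord i; lia.
by have := mD i (Ordinal lastP); have := ltn_ord i => /=; lia.
Qed.

Lemma alternatingB g g' : alternating g -> alternating g' -> alternating (g - g').
Proof. by move=> gP gP' s; rewrite msymB gP gP' mulrBr. Qed.

(** Both sides are alternating and agree at the exponents la + rho, which are all the strictly
    decreasing ones. The list [Q] makes the sum finite. *)
Lemma alternating_expand g (Q : seq intpart) : alternating g -> uniq Q ->
    (forall la, (size la <= n)%N -> g@_(mshifted n la) != 0 -> la \in Q) ->
  g = \sum_(la <- Q | (size la <= n)%N)
        g@_(mshifted n la) *: alt (@mvar R n) (shifted n la).
Proof.
move=> gP Quniq gQ; apply/eqP; rewrite -subr_eq0; apply/eqP.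
apply: alternating_eq0 => [|m mP].
  apply: alternatingB => // s; rewrite raddf_sum mulr_sumr; apply: eq_bigr => la _.
  by rewrite /= msymZ alternating_alt scalerAr.
have [ka leka ->] := ex_mshifted mP; rewrite mcoeffB raddf_sum /=.
have altE la : (size la <= n)%N ->
    (alt (@mvar R n) (shifted n la))@_(mshifted n ka) = (ka == la)%:R.
  move=> lela; rewrite mcoeff_alt; last 1 first.
  - by move=> i j /(shifted_decr ka); rewrite !mnmE.
  - congr (_%:R); apply: congr1; apply/eqP/eqP => [|-> //].
    exact: mshifted_inj.
  exact: shifted_decr.
under eq_bigr => la lela do rewrite mcoeffZ altE //.
have [kaQ|kaNQ] := boolP (ka \in Q).
  rewrite big_mkcond (bigD1_seq ka) //= leka eqxx mulr1 big1 ?addr0 ?subrr //.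
  by move=> la /negbTE nela; rewrite eq_sym nela mulr0; case: ifP.
rewrite big1_seq ?subr0; last first.
  move=> la /andP[_ laQ]; case: eqP laQ => [<-|]; last by rewrite mulr0.
  by rewrite (negbTE kaNQ).
by apply/eqP; apply: contraNT kaNQ; apply: gQ.
Qed.

End AlternatingExpansion.

(** The partitions inside an M by M square. They include all partitions of size at most [M], so one
    such list can index every finite sum below. *)
Definition boxed_parts (M : nat) : seq intpart :=
  pmap insub [seq map (@nat_of_ord M.+1) (val s) | s : M.-bseq 'I_M.+1].

Lemma uniq_boxed_parts M : uniq (boxed_parts M).
Proof.
apply: pmap_sub_uniq; rewrite map_inj_uniq ?enum_uniq // => s t est.
by apply/val_inj/(inj_map _ est)/ord_inj.
Qed.

Lemma mem_boxed_parts M (la : intpart) :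
  (size la <= M)%N -> (forall k, k \in (la : seq nat) -> (k <= M)%N) ->
  la \in boxed_parts M.
Proof.
move=> sla leM; rewrite mem_pmap_sub.
have ss : (size [seq (inord k : 'I_M.+1) | k <- la] <= M)%N by rewrite size_map.
apply/mapP; exists (Bseq ss); first by rewrite mem_enum.
rewrite /= -map_comp -[LHS]map_id; apply/eq_in_map => k /leM lekM /=.
by rewrite inordK.
Qed.

Lemma leq_sumn_mem (s : seq nat) k : k \in s -> (k <= sumn s)%N.
Proof.
elim: s => //= a s IHs; rewrite inE => /orP[/eqP->|/IHs]; first exact: leq_addr.
by move=> le; apply: leq_trans le (leq_addl _ _).
Qed.

Lemma mem_boxed_parts_sumn M (la : intpart) :
  (sumn la <= M)%N -> la \in boxed_parts M.
Proof.
move=> leM; apply: mem_boxed_parts => [|k /leq_sumn_mem lek]; last exact: leq_trans leM.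
apply: leq_trans leM; have := intpart_neq0 la; elim: (parts la) => //= k s IHs.
by rewrite inE negb_or eq_sym -lt0n => /andP[k_gt0 /IHs]; lia.
Qed.

(** * Schur polynomials as quotients of alternants *)

Section SchurRatio.

Variable n : nat.
Implicit Types (la ka mu nu : intpart).

Definition rho_alt : {mpoly int[n]} := alt (@mvar _ n) (shifted n [::]).

Definition svar la : {mpoly int[n]} := spoly (codom (@mvar _ n)) la.

Lemma shifted_nil_decr : strictly_decreasing (shifted n [::] : 'I_n -> nat).
Proof. by move=> i j ltij; rewrite /shifted !nth_nil; have := ltn_ord j; lia. Qed.

Lemma rho_alt_neq0 : rho_alt != 0.
Proof.
suff : rho_alt@_(mshifted n [::]) != 0 by apply: contraNneq => ->; rewrite mcoeff0.
rewrite mcoeff_alt ?eqxx ?oner_eq0 //; first exact: shifted_nil_decr.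
by move=> i j /shifted_nil_decr; rewrite !mnmE.
Qed.

Lemma svarM la : (size la <= n)%N -> svar la * rho_alt = alt (@mvar _ n) (shifted n la).
Proof. by move=> lela; rewrite alt_spoly. Qed.

Lemma svar_eq0 la : (n < size la)%N -> svar la = 0.
Proof. by move=> lt; apply: spoly_eq0; rewrite size_codom card_ord. Qed.

(** The numerator is [svar la] times the denominator, so the fraction is a polynomial. *)
Lemma schurE la : schur n la = tofrac (svar la).
Proof.
rewrite /schur; case: ifP => [lela|/negbT]; last first.
  by rewrite -ltnNge => /svar_eq0->; rewrite rmorph0.
have -> : alternant (fun j : 'I_n => nth 0%N la j + (n.-1 - j))%N = svar la * rho_alt.
  by rewrite svarM.
have -> : alternant (fun j : 'I_n => n.-1 - j)%N = rho_alt.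
  congr (\det _); apply/matrixP => i j; by rewrite !mxE /shifted nth_nil.
by rewrite tofracM mulfK // tofrac_eq0 rho_alt_neq0.
Qed.

Lemma msym_svar la s : msym s (svar la) = svar la.
Proof.
have [ltn|lela] := ltnP n (size la); first by rewrite svar_eq0 // msym0.
apply: (mulIf rho_alt_neq0); apply: (can_inj (signrMK (odd_perm s))).
rewrite mulrCA -(@alternating_alt _ n (shifted n [::]) s) -msymM.
by rewrite svarM // alternating_alt.
Qed.

Lemma mcoeff_svar_rho la ka : (size ka <= n)%N ->
  (svar la * rho_alt)@_(mshifted n ka) = (ka == la)%:R.
Proof.
move=> leka; have [ltla|lela] := ltnP n (size la).
  rewrite svar_eq0 // mul0r mcoeff0; case: eqP => // eka.
  by rewrite eka leqNgt ltla in leka.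
rewrite svarM // mcoeff_alt; last 1 first.
- by move=> i j /(shifted_decr ka); rewrite !mnmE.
- congr (_%:R); apply: congr1; apply/eqP/eqP => [|-> //]; exact: mshifted_inj.
exact: shifted_decr.
Qed.

Lemma mcoeff_sum_svar (Q : seq intpart) (c : intpart -> int) ka :
    uniq Q -> (size ka <= n)%N ->
  ((\sum_(la <- Q) svar la *~ c la) * rho_alt)@_(mshifted n ka)
    = if ka \in Q then c ka else 0.
Proof.
move=> Quniq leka; rewrite mulr_suml raddf_sum /=.
under eq_bigr => la _ do rewrite mulrzAl raddfMz /= mcoeff_svar_rho //.
case: ifPn => kaQ; last first.
  rewrite big1_seq // => la /andP[_ laQ]; case: eqP laQ => [<-|]; last by rewrite mul0rz.
  by rewrite (negbTE kaQ).
rewrite (bigD1_seq ka) //= eqxx intz big1 ?addr0 // => la /negbTE nela.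
by rewrite eq_sym nela mul0rz.
Qed.

(** For [n] at least the length of [la], this is the coefficient of s_la in s_mu s_nu: among the
    products s_ka a_rho, only that of ka = la has the monomial la + rho. *)
Definition prod_coef mu nu la : int :=
  (svar mu * svar nu * rho_alt)@_(mshifted n la).

End SchurRatio.

(** * Homogeneity *)

Section Homogeneity.

Variable n : nat.

Lemma dhomog_bigprod (I : finType) (F : I -> {mpoly int[n]}) d :
  (forall i, F i \is (d i).-homog) -> \prod_i F i \is (\sum_i d i)%N.-homog.
Proof.
by move=> FP; apply: (big_rec2 (fun p d => p \is d.-homog)) => [|i d' p _ pP];
  [exact: dhomog1 | exact: dhomogM].
Qed.

Lemma dhomog_hsym (s : seq {mpoly int[n]}) k :
  all (fun p => p \is 1.-homog) s -> hsym s k \is k.-homog.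
Proof.
elim: s k => [|u s IHs] k; first by case: k => [|k] _; [exact: dhomog1 | exact: dhomog0].
case/andP=> u1 s1; elim: k => [|k IHk]; first by rewrite hsym0; exact: dhomog1.
by rewrite hsym_consS; apply: dhomogD; [exact: IHs | rewrite -add1n; exact: dhomogM].
Qed.

(** In each term of the Jacobi-Trudi determinant either some index is negative and the term
    vanishes, or the indices add up to the size of [la], whatever the permutation. *)
Lemma dhomog_svar la : svar n la \is (sumn la).-homog.
Proof.
pose l := size la; rewrite /svar /spoly /jt /determinant.
have X1 : all (fun p => p \is 1.-homog) (codom (@mvar int n)).
  by apply/allP => _ /codomP[i ->]; rewrite dhomogX; exact/eqP/mdeg1.
apply: rpred_sum => s _.
suff hs : \prod_(i < l) hsym_sub (codom (@mvar int n)) (shifted l la i) (l.-1 - s i)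
    \is (sumn la).-homog.
  rewrite mulr_sign; under eq_bigr => i _ do rewrite mxE.
  by case: ifP; rewrite ?dhomogN.
have [/existsP[i lti]|] := boolP [exists i : 'I_l, (shifted l la i < l.-1 - s i)%N].
  by rewrite (bigD1 i) //= hsym_sub0 // mul0r dhomog0.
rewrite negb_exists => /forallP le; have {}le i : (l.-1 - s i <= shifted l la i)%N.
  by have := le i; rewrite -leqNgt.
have -> : sumn la = (\sum_(i < l) (shifted l la i - (l.-1 - s i)))%N.
  rewrite sumnB; last by move=> i _; apply: le.
  have -> : (\sum_(i < l) (l.-1 - s i) = \sum_(i < l) (l.-1 - i))%N.
    by rewrite [RHS](reindex_inj (@perm_inj _ s)).
  by rewrite /shifted big_split /= addnK sumnE (big_nth 0%N) big_mkord.
by apply: dhomog_bigprod => i; rewrite /hsym_sub le; apply: dhomog_hsym.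
Qed.

Lemma dhomog_rho_alt : rho_alt n \is (\sum_(j < n) (n.-1 - j))%N.-homog.
Proof.
rewrite /rho_alt alt_mvar; apply: rpred_sum => s _; rewrite mulr_sign.
have hX : ('X_[[multinom shifted n [::] (s i) | i < n]] : {mpoly int[n]})
    \is (\sum_(j < n) (n.-1 - j))%N.-homog.
  rewrite dhomogX; apply/eqP/(etrans (mdegE _)); rewrite [RHS](reindex_inj (@perm_inj _ s)) /=.
  by apply: eq_bigr => i _; rewrite mnmE /shifted nth_nil.
by case: ifP; rewrite ?dhomogN.
Qed.

(** Comparison of degrees at the monomial la + rho. It confines the expansion of a product to
    finitely many partitions, uniformly in [n]. *)
Lemma prod_coef_sumn (mu nu la : intpart) : (size la <= n)%N ->
  prod_coef n mu nu la != 0 -> sumn la = (sumn mu + sumn nu)%N.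
Proof.
move=> lela; rewrite -mcoeff_msupp.
have := dhomogM (dhomogM (dhomog_svar mu) (dhomog_svar nu)) dhomog_rho_alt.
move=> /dhomogP h /h /(etrans (esym (mdegE _))).
under eq_bigr => i _ do rewrite mnmE.
rewrite big_split /= => /addIn <-.
rewrite sumnE (big_nth 0%N) big_mkord.
rewrite -!(big_mkord xpredT (nth 0%N la)) (big_cat_nat (leq0n _) lela) /=.
rewrite [X in (_ + X)%N]big_nat_cond [X in (_ + X)%N]big1 ?addn0 // => i.
by case/andP=> /andP[lei _] _; rewrite nth_default.
Qed.

End Homogeneity.

(** * Setting the last variables to zero *)

Section Restriction.

Variables n n' : nat.
Hypothesis le_n : (n <= n')%N.

Definition restr_var (i : 'I_n') : {mpoly int[n]} :=
  if insub (val i) is Some j then 'X_j else 0.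

Definition restr : {mpoly int[n']} -> {mpoly int[n]} := mmap (@mpolyC n int) restr_var.

HB.instance Definition _ := GRing.RMorphism.on restr.

Lemma restr_svar la : restr (svar n' la) = svar n la.
Proof.
rewrite -[LHS]spoly_map.
suff -> : map restr (codom (@mvar _ n')) = codom (@mvar int n) ++ nseq (n' - n) 0.
  by rewrite spoly_cat_nseq0.
have sz (m : nat) (T : Type) (f : 'I_m -> T) : size (codom f) = m.
  by rewrite size_codom card_ord.
apply: (@eq_from_nth _ 0); first by rewrite size_map size_cat size_nseq !sz subnKC.
move=> i; rewrite size_map sz => lti; rewrite (nth_map 0) ?sz //.
have nthc (m : nat) (R : comNzRingType) (f : 'I_m -> R) (j : 'I_m) :
  nth 0 (codom f) j = f j by rewrite (nth_map j) ?size_enum_ord // nth_ord_enum.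
rewrite (nthc _ _ _ (Ordinal lti)) nth_cat sz.
rewrite /restr /mvar mmapX mmap1U /restr_var /=.
case: ltnP => [ltin|lein]; last by rewrite insubN -?leqNgt // nth_nseq if_same.
by rewrite insubT (nthc _ _ _ (Ordinal ltin)); congr 'X_ _; apply: val_inj.
Qed.

End Restriction.

(** * Littlewood-Richardson coefficients as polynomial coefficients *)

Section LittlewoodRichardson.

Variables mu nu : intpart.
Let N := (sumn mu + sumn nu)%N.

Lemma svarM_expand n (Q : seq intpart) : uniq Q ->
    (forall la : intpart, sumn la = N -> la \in Q) ->
  svar n mu * svar n nu = \sum_(la <- Q) svar n la *~ prod_coef n mu nu la.
Proof.
move=> Quniq QP; apply: (mulIf (rho_alt_neq0 n)).
have altg : alternating (svar n mu * svar n nu * rho_alt n).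
  by move=> s; rewrite !msymM !msym_svar alternating_alt mulrCA mulrA.
rewrite {1}(alternating_expand _ altg Quniq); first last.
- by move=> la lela nz; apply/QP/(prod_coef_sumn lela nz).
- by move=> x ex; lia.
rewrite [RHS]mulr_suml [LHS]big_mkcond; apply: eq_bigr => la _.
case: ifPn => [lela|]; last by rewrite -ltnNge => lt; rewrite svar_eq0 // mul0rz mul0r.
by rewrite mulrzAl svarM // -scaler_int intz.
Qed.

(** Restriction to [n] variables keeps the coefficients of the expansion in [n'] variables, and
    those with at most [n] parts can still be read off. *)
Lemma prod_coef_stable n n' (la : intpart) : (n <= n')%N -> (size la <= n)%N ->
  prod_coef n' mu nu la = prod_coef n mu nu la.
Proof.
move=> le_n lela; have lela' := leq_trans lela le_n.
have Quniq := uniq_boxed_parts (sumn la + N).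
have QP (ka : intpart) : sumn ka = N -> ka \in boxed_parts (sumn la + N).
  by move=> eka; apply: mem_boxed_parts_sumn; rewrite eka leq_addl.
rewrite [RHS]/prod_coef -!(restr_svar le_n) -rmorphM (svarM_expand _ Quniq QP).
rewrite rmorph_sum; under eq_bigr => ka _ do rewrite rmorphMz /= restr_svar //.
by rewrite mcoeff_sum_svar // mem_boxed_parts_sumn ?leq_addr.
Qed.

Lemma schur_expansionP (c : {fsfun intpart -> int with 0}) :
  schur_expansion (fun n => schur n mu * schur n nu) c <->
  forall n, svar n mu * svar n nu = \sum_(la <- finsupp c) svar n la *~ c la.
Proof.
have sumE n : \sum_(la <- finsupp c) schur n la *~ c la
    = tofrac (\sum_(la <- finsupp c) svar n la *~ c la).
  by rewrite rmorph_sum; apply: eq_bigr => la _; rewrite schurE rmorphMz.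
split=> h n; have := h n; rewrite ?sumE !schurE -tofracM; last by move->.
by move/eqP; rewrite tofrac_eq => /eqP.
Qed.

Lemma schur_expansion_coef c la : schur_expansion (fun n => schur n mu * schur n nu) c ->
  c la = prod_coef (size la) mu nu la.
Proof.
move/schur_expansionP => cP; rewrite /prod_coef cP mcoeff_sum_svar ?fset_uniq //.
by case: finsuppP.
Qed.

Lemma ex_schur_expansion :
  exists c, schur_expansion (fun n => schur n mu * schur n nu) c.
Proof.
pose Q := [seq la : intpart <- boxed_parts N | sumn la == N].
(* A partition of [N] has at most [N] parts, so [N] variables determine all coefficients. *)
exists [fsfun la in [fset la in Q]%fset => prod_coef N mu nu la | 0].
set c := [fsfun _ in _ => _ | _].
apply/schur_expansionP => n.
have Quniq : uniq Q by rewrite filter_uniq // uniq_boxed_parts.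
have QP (la : intpart) : la \in Q = (sumn la == N).
  by rewrite mem_filter andb_idr // => /eqP <-; apply: mem_boxed_parts_sumn.
have QP' (la : intpart) : sumn la = N -> la \in Q by rewrite QP => ->.
rewrite (svarM_expand n Quniq QP').
have cE la : c la = if la \in Q then prod_coef N mu nu la else 0.
  by rewrite fsfunE inE.
have -> : \sum_(la <- Q) svar n la *~ prod_coef n mu nu la
        = \sum_(la <- Q) svar n la *~ c la.
  rewrite big_seq [RHS]big_seq; apply: eq_bigr => la laQ; rewrite cE laQ.
  have [ltn|lela] := ltnP n (size la); first by rewrite svar_eq0 // !mul0rz.
  have leN : (size la <= N)%N.
    move: laQ; rewrite QP => /eqP <-; have := intpart_neq0 la.
    elim: (parts la) => //= k s IHs.
    by rewrite inE negb_or eq_sym -lt0n => /andP[k_gt0 /IHs]; lia.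
  have [leNn|/ltnW lenN] := leqP N n; first by rewrite (prod_coef_stable leNn).
  by rewrite (prod_coef_stable lenN).
rewrite (bigID [pred la | c la == 0]) /= big1 ?add0r; last first.
  by move=> la /eqP->.
rewrite -big_filter; apply: perm_big; apply: uniq_perm => [||la];
  [exact: filter_uniq | exact: fset_uniq |].
rewrite mem_filter mem_finsupp; apply: andb_idr.
by rewrite cE; case: ifP => //; rewrite eqxx.
Qed.

(** [xget] picks an unknown expansion, but the coefficients of every expansion are forced by
    [schur_expansion_coef]; existence is all that remains. *)
Lemma LR_prod_coef n (la : intpart) : (size la <= n)%N ->
  LR mu nu la = prod_coef n mu nu la.
Proof.
move=> lela; have := xgetPex [fsfun] ex_schur_expansion.
rewrite /LR /schur_coef => /schur_expansion_coef->.
by rewrite (prod_coef_stable lela).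
Qed.

Lemma LR_neq0_sumn (la : intpart) : LR mu nu la != 0 -> sumn la = N.
Proof. by rewrite (LR_prod_coef (leqnn _)) => /(prod_coef_sumn (leqnn _)). Qed.

End LittlewoodRichardson.

(** * Finitely supported sums as sums over lists *)

Section FiniteSums.

Variables (I : choiceType) (F : I -> int).

Lemma fsum_seq (s : seq I) : uniq s -> (forall i, F i != 0 -> i \in s) ->
  \sum_(i \in [set: I]) F i = \sum_(i <- s) F i.
Proof.
move=> s_uniq sP; rewrite (@fsbigTE _ _ _ _ [fset i in s]%fset); last first.
  by move=> i; rewrite inE => /negP iNs; apply/eqP; apply: contraT => /sP.
apply: perm_big; apply: uniq_perm => [||i]; rewrite ?fset_uniq //.
by rewrite inE.
Qed.

Lemma fsum_neq0 : \sum_(i \in [set: I]) F i != 0 -> exists i, F i != 0.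
Proof.
move=> sum_neq0; apply/not_existsP => F0; case/eqP: sum_neq0.
by rewrite (@fsum_seq [::]) ?big_nil // => i /F0.
Qed.

End FiniteSums.

(** * The commutative ring of graded finite series *)

Definition degree (E : zmodType) (D : {additive E -> int}) (d : E) : int := D d.

Section GradedSeries.

Variables (E : zmodType) (D : {additive E -> int}).
Local Notation deg := (degree D).

Lemma degree0 : deg 0 = 0. Proof. exact: raddf0. Qed.
Lemma degreeD d e : deg (d + e) = deg d + deg e. Proof. exact: raddfD. Qed.
Lemma degreeN d : deg (- d) = - deg d. Proof. exact: raddfN. Qed.
Lemma degreeB d e : deg (d - e) = deg d - deg e. Proof. exact: raddfB. Qed.

Implicit Types (d e : E) (N : int).

(* The products of [series] are well behaved on this class: for a given exponent
   only finitely many terms contribute. *)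
Definition graded_finite (f : series E) : Prop :=
  (forall d, f d != 0 -> 0 <= deg d)
  /\ (forall N, exists s : seq E, forall d, f d != 0 -> deg d <= N -> d \in s).

Record gser := GSer { gcoef :> E -> int; gcoefP : graded_finite gcoef }.

HB.instance Definition _ := gen_eqMixin gser.
HB.instance Definition _ := gen_choiceMixin gser.

Implicit Types f g h : gser.

Lemma gserP f g : (forall d, f d = g d) -> f = g.
Proof.
case: f g => [f fP] [g gP] /= /funext efg; subst g.
by congr GSer; apply: Prop_irrelevance.
Qed.

Lemma gdeg_ge0 f d : f d != 0 -> 0 <= deg d.
Proof. by case: (gcoefP f) => + _; apply. Qed.

Lemma gser_cover f N : exists2 s : seq E, uniq s &
  forall d, f d != 0 -> deg d <= N -> d \in s.
Proof.
case: (gcoefP f) => _ /(_ N)[s sP]; exists (undup s); first exact: undup_uniq.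
by move=> d; rewrite mem_undup; apply: sP.
Qed.

Fact graded_finite0 : graded_finite (fun=> 0).
Proof. by split=> [d|N]; [|exists [::] => d]; rewrite eqxx. Qed.

Fact graded_finiteD f g : graded_finite (fun d => f d + g d).
Proof.
have fg0 d : f d + g d != 0 -> f d != 0 \/ g d != 0.
  by have [->|] := eqVneq (f d) 0; [rewrite add0r; right | left].
split=> [d /fg0[]|N]; try exact: gdeg_ge0.
have [s _ sP] := gser_cover f N; have [t _ tP] := gser_cover g N.
by exists (s ++ t) => d /fg0[/sP|/tP] h /h; rewrite mem_cat => ->; rewrite ?orbT.
Qed.

Fact graded_finiteN f : graded_finite (fun d => - f d).
Proof.
split=> [d|N]; first by rewrite oppr_eq0 => /gdeg_ge0.
by have [s _ sP] := gser_cover f N; exists s => d; rewrite oppr_eq0; apply: sP.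
Qed.

Lemma smul_neq0 (f g : series E) d : smul f g d != 0 ->
  exists2 e, f e != 0 & g (d - e) != 0.
Proof.
by case/fsum_neq0 => e; rewrite mulf_eq0 negb_or => /andP[fe ge]; exists e.
Qed.

Fact graded_finiteM f g : graded_finite (smul (gcoef f) (gcoef g)).
Proof.
split=> [d /smul_neq0[e /gdeg_ge0 fe /gdeg_ge0]|N].
  rewrite degreeB subr_ge0; exact: le_trans.
have [s _ sP] := gser_cover f N; have [t _ tP] := gser_cover g N.
exists [seq a + b | a <- s, b <- t] => d /smul_neq0[e fe ge] led.
have := gdeg_ge0 fe; have := gdeg_ge0 ge; rewrite degreeB => ge0 fe0.
apply/allpairsP; exists (e, d - e); split=> /=; last by rewrite addrC subrK.
  by apply: sP => //; lia.
by apply: tP; rewrite // degreeB; lia.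
Qed.

Fact graded_finite1 : graded_finite (smono 0).
Proof.
by split=> [d|N]; [|exists [:: 0] => d]; rewrite /smono ?inE;
  have [->|_] := eqVneq d 0; rewrite ?degree0 ?eqxx.
Qed.

Definition gser0 := GSer graded_finite0.
Definition gser1 := GSer graded_finite1.
Definition gserD f g := GSer (graded_finiteD f g).
Definition gserN f := GSer (graded_finiteN f).
Definition gserM f g := GSer (graded_finiteM f g).

Fact gserDA : associative gserD.
Proof. by move=> f g h; apply: gserP => d; apply: addrA. Qed.
Fact gserDC : commutative gserD.
Proof. by move=> f g; apply: gserP => d; apply: addrC. Qed.
Fact gser0D : left_id gser0 gserD.
Proof. by move=> f; apply: gserP => d; apply: add0r. Qed.
Fact gserND : left_inverse gser0 gserN gserD.
Proof. by move=> f; apply: gserP => d; apply: addNr. Qed.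

HB.instance Definition _ := GRing.isZmodule.Build gser gserDA gserDC gser0D gserND.

(** Since [g] lives in nonnegative degrees, only exponents [e] of degree at most that of [d]
    contribute; any list that covers those of [f] will do. *)
Lemma gserM_seq f g d N (s : seq E) : deg d <= N -> uniq s ->
    (forall e, f e != 0 -> deg e <= N -> e \in s) ->
  smul (gcoef f) (gcoef g) d = \sum_(e <- s) f e * g (d - e).
Proof.
move=> led s_uniq sP; apply: fsum_seq => // e; rewrite mulf_eq0 negb_or.
case/andP=> fe /gdeg_ge0; rewrite degreeB => ge0; apply: sP => //.
by move: ge0 => /=; lia.
Qed.

Fact gserMC : commutative gserM.
Proof.
move=> f g; apply: gserP => d /=.
have [s s_uniq sP] := gser_cover f (deg d).
rewrite (gserM_seq _ (lexx _) s_uniq sP) /smul.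
rewrite (@fsum_seq _ _ [seq d - e | e <- s]).
- by rewrite big_map; apply: eq_bigr => e _; rewrite mulrC subKr.
- by rewrite map_inj_uniq // => a b /addrI/oppr_inj.
move=> e; rewrite mulf_eq0 negb_or => /andP[ge fe]; apply/mapP.
exists (d - e); rewrite ?subKr //; apply: sP => //.
by rewrite degreeB; have := gdeg_ge0 ge; lia.
Qed.

Fact gserMA : associative gserM.
Proof.
move=> f g h; apply: gserP => d /=.
have [s s_uniq sP] := gser_cover f (deg d).
have [t t_uniq tP] := gser_cover g (deg d).
(* Sums of relevant exponents of [f] and [g]: they cover the support of the product up to the degree
   of [d]. *)
pose st := undup [seq a + b | a <- s, b <- t].
rewrite (@gserM_seq f (gserM g h) _ _ _ (lexx _) s_uniq sP).
rewrite (@gserM_seq (gserM f g) h _ _ st (lexx _)) ?undup_uniq //; last first.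
  move=> e /smul_neq0[a fa ga] lee; rewrite mem_undup; apply/allpairsP.
  have := gdeg_ge0 fa; have := gdeg_ge0 ga; rewrite degreeB => ga0 fa0.
  exists (a, e - a); split=> /=; last by rewrite addrC subrK.
    by apply: sP => //; lia.
  by apply: tP; rewrite // degreeB; lia.
have -> : \sum_(e <- st) gserM f g e * h (d - e)
   = \sum_(e <- st) \sum_(a <- s) f a * g (e - a) * h (d - e).
  apply: eq_bigr => e _; have [->|he] := eqVneq (h (d - e)) 0.
    by rewrite mulr0 big1 // => a _; rewrite mulr0.
  have lee : deg e <= deg d by have := gdeg_ge0 he; rewrite degreeB; lia.
  by rewrite /= (gserM_seq g lee s_uniq sP) mulr_suml.
rewrite exchange_big /=; apply: eq_bigr => a _.
have [->|fa] := eqVneq (f a) 0; first by rewrite mul0r big1 // => e _; rewrite !mul0r.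
have fa0 := gdeg_ge0 fa.
rewrite (@gserM_seq g h (d - a) (deg d) t) //; last by rewrite degreeB; lia.
under [RHS]eq_bigr => e _ do rewrite -mulrA.
rewrite -mulr_sumr; congr (_ * _).
(* The inner sum is extended to all exponents [b] and then taken over [st] again by b = e - a. *)
rewrite -(@fsum_seq _ (fun b => g b * h (d - a - b))) //; last first.
  move=> b; rewrite mulf_eq0 negb_or => /andP[gb /gdeg_ge0].
  by rewrite !degreeB => hb; apply: tP => //; lia.
rewrite (@fsum_seq _ _ [seq e - a | e <- st]).
- by rewrite big_map; apply: eq_bigr => e _; rewrite opprB addrA subrK.
- by rewrite map_inj_uniq ?undup_uniq // => x y /addIr.
move=> b; rewrite mulf_eq0 negb_or => /andP[gb hb].
have := gdeg_ge0 gb; have := gdeg_ge0 hb; rewrite !degreeB => hb0 gb0.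
have [led|] := boolP (a \in s); last by rewrite sP //; lia.
apply/mapP; exists (a + b); last by rewrite addrAC subrr add0r.
by rewrite mem_undup; apply/allpairsP; exists (a, b); split=> //=; apply: tP => //; lia.
Qed.

Fact gser1M : left_id gser1 gserM.
Proof.
move=> f; apply: gserP => d /=; rewrite /smul (@fsum_seq _ _ [:: 0]) //.
  by rewrite big_seq1 /smono eqxx mul1r subr0.
by move=> e; rewrite inE /smono; have [//|_] := eqVneq e 0; rewrite mul0r eqxx.
Qed.

Fact gserMD : left_distributive gserM gserD.
Proof.
move=> f g h; apply: gserP => d /=.
have [s s_uniq sP] := gser_cover f (deg d).
have [t t_uniq tP] := gser_cover g (deg d).
pose st := undup (s ++ t).
have sstP e : f e != 0 -> deg e <= deg d -> e \in st.
  by rewrite mem_undup mem_cat => fe le; rewrite sP.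
have tstP e : g e != 0 -> deg e <= deg d -> e \in st.
  by rewrite mem_undup mem_cat => fe le; rewrite tP // orbT.
rewrite (gserM_seq h (lexx _) (undup_uniq _) sstP).
rewrite (gserM_seq h (lexx _) (undup_uniq _) tstP).
rewrite (@gserM_seq (gserD f g) h _ _ st (lexx _)) ?undup_uniq //.
  by rewrite -big_split /=; apply: eq_bigr => e _; rewrite mulrDl.
move=> e /=; have [->|fe _] := eqVneq (f e) 0; last exact: sstP.
by rewrite add0r; apply: tstP.
Qed.

Fact gser1_neq0 : gser1 != 0.
Proof.
apply/eqP => /(congr1 (fun f : gser => f 0)) /=.
by rewrite /smono eqxx => /eqP; rewrite oner_eq0.
Qed.

HB.instance Definition _ := GRing.Zmodule_isComNzRing.Build gser
  gserMA gserMC gser1M gserMD gser1_neq0.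

End GradedSeries.

(** * Monomials, geometric series and congruences modulo high degree *)

Section GradedSeriesTheory.

Variables (E : zmodType) (D : {additive E -> int}).
Local Notation deg := (degree D).
Implicit Types (d e : E) (f g : gser D) (k : int).

Lemma gcoef0 d : (0 : gser D) d = 0. Proof. by []. Qed.

Lemma gcoefN f d : (- f) d = - f d. Proof. by []. Qed.

Lemma gcoefD f g d : (f + g) d = f d + g d. Proof. by []. Qed.

Lemma gcoefB f g d : (f - g) d = f d - g d. Proof. by []. Qed.

Lemma gcoefM f g : gcoef (f * g) = smul (gcoef f) (gcoef g). Proof. by []. Qed.

Lemma gcoef1 d : (1 : gser D) d = (d == 0)%:R. Proof. by []. Qed.

Lemma gcoef_sum (I : Type) (r : seq I) (P : pred I) (F : I -> gser D) d :
  (\sum_(i <- r | P i) F i) d = \sum_(i <- r | P i) F i d.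
Proof. exact: (big_morph (fun f : gser D => f d) (fun f g => gcoefD f g d) (gcoef0 d)). Qed.

Lemma gcoefMz f z d : (f *~ z) d = f d * z.
Proof.
have Mn (n : nat) : (f *+ n) d = f d *+ n.
  by elim: n => [|n IHn]; rewrite ?mulr0n // !mulrS gcoefD IHn.
case: z => n; first by rewrite -pmulrn Mn -mulr_natr natz.
by rewrite NegzE mulrNz gcoefN -pmulrn Mn mulrN -mulr_natr natz.
Qed.

Fact graded_finite_mono e :
  graded_finite D (fun d => if 0 <= deg e then (d == e)%:R else 0).
Proof.
by split=> [d|N]; [|exists [:: e] => d]; rewrite ?inE; case: ifP => //;
  have [->|] := eqVneq d e.
Qed.

(* Junk value 0 outside of the exponents of nonnegative degree. *)
Definition gmono e : gser D := GSer (graded_finite_mono e).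

Lemma gcoef_mono e d : 0 <= deg e -> gmono e d = (d == e)%:R.
Proof. by rewrite /= => ->. Qed.

Lemma gcoef_monoM e f d : 0 <= deg e -> (gmono e * f) d = f (d - e).
Proof.
move=> e0; rewrite gcoefM /smul (@fsum_seq _ _ [:: e]) // => [|e'].
  by rewrite big_seq1 gcoef_mono // eqxx mul1r.
by rewrite gcoef_mono // inE; have [//|_] := eqVneq e' e; rewrite mul0r eqxx.
Qed.

Lemma gmono0 : gmono 0 = 1.
Proof. by apply: gserP => d; rewrite gcoef_mono ?degree0. Qed.

Lemma gmonoD e e' : 0 <= deg e -> 0 <= deg e' ->
  gmono (e + e') = gmono e * gmono e'.
Proof.
move=> e0 e'0; apply: gserP => d; rewrite gcoef_monoM // !gcoef_mono //.
  by rewrite subr_eq addrC.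
by rewrite degreeD addr_ge0.
Qed.

Lemma gmonoXn e n : 0 <= deg e -> gmono (e *+ n) = gmono e ^+ n.
Proof.
move=> e0; elim: n => [|n IHn]; first by rewrite mulr0n gmono0.
rewrite mulrS gmonoD // ?IHn ?exprS //.
by elim: (n) => [|k IHk]; rewrite ?mulr0n ?degree0 // mulrS degreeD addr_ge0.
Qed.

Lemma gmono_sum (I : Type) (r : seq I) (F : I -> E) : (forall i, 0 <= deg (F i)) ->
  gmono (\sum_(i <- r) F i) = \prod_(i <- r) gmono (F i).
Proof.
move=> F0; elim: r => [|i r IHr]; first by rewrite !big_nil gmono0.
rewrite !big_cons gmonoD ?IHr // /degree raddf_sum.
by apply: sumr_ge0 => j _; apply: F0.
Qed.

Lemma gcoef_one_minus e : 0 <= deg e -> gcoef (1 - gmono e) = one_minus e.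
Proof. by move=> e0; apply/funext => d; rewrite gcoefB gcoef_mono. Qed.

Lemma degreeMn e n : deg (e *+ n) = deg e * n%:Z.
Proof. by rewrite /degree raddfMn /= -mulr_natr natz. Qed.

Section Geometric.

Variable e : E.
Hypothesis e_gt0 : 0 < deg e.

Lemma mulrn_degree_inj : injective (fun n => e *+ n).
Proof.
move=> m n /= emn; have := congr1 deg emn; rewrite !degreeMn.
by move/(mulfI (lt0r_neq0 e_gt0)) => [].
Qed.

Lemma geom_mulrn n : geom e (e *+ n) = 1.
Proof.
rewrite /geom (@fsum_seq _ _ [:: n]) ?big_seq1 /smono ?eqxx // => m.
rewrite (inj_eq mulrn_degree_inj) inE => nz; rewrite eq_sym.
by apply: contraNT nz => /negbTE->.
Qed.

Lemma geom_neq0 d : geom e d != 0 -> exists n, d = e *+ n.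
Proof. by case/fsum_neq0 => n; rewrite /smono; have [->|] := eqVneq d (e *+ n); exists n. Qed.

End Geometric.

Fact graded_finite_geom e :
  graded_finite D (fun d => if 0 < deg e then geom e d else 0).
Proof.
case e_gt0: (0 < deg e); last exact: graded_finite0.
split=> [d /geom_neq0[n ->]|N]; first by rewrite degreeMn mulr_ge0 // ltW.
exists [seq e *+ n | n <- iota 0 `|N|.+1] => d /geom_neq0[n ->].
rewrite degreeMn => le; apply/map_f; rewrite mem_iota /= add0n ltnS.
have : (n%:Z <= N) by apply: le_trans le; rewrite ler_peMl.
lia.
Qed.

(** Zero by convention unless [e] has positive degree, which leaves finitely many multiples of [e]
    below each bound. *)
Definition ggeom e : gser D := GSer (graded_finite_geom e).

Lemma gcoef_geom e : 0 < deg e -> gcoef (ggeom e) = geom e.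
Proof. by move=> e_gt0; apply/funext => d; rewrite /= e_gt0. Qed.

Lemma ggeomK e : 0 < deg e -> (1 - gmono e) * ggeom e = 1.
Proof.
move=> e_gt0; have e_ge0 := ltW e_gt0.
apply: gserP => d; rewrite mulrBl mul1r gcoefB gcoef_monoM // gcoef_geom // gcoef1.
have [/geom_neq0[n ->]|] := boolP (geom e d != 0).
  rewrite geom_mulrn //; case: n => [|n]; last first.
    rewrite mulrS addrAC subrr add0r geom_mulrn // subrr -mulrS.
    by rewrite -(mulr0n e) (inj_eq (mulrn_degree_inj e_gt0)).
  rewrite mulr0n eqxx; have [/geom_neq0[n]|/negPn/eqP->] := boolP (geom e (0 - e) != 0).
    move/(congr1 deg); rewrite degreeMn degreeB degree0; move: e_gt0.
    by move: (deg e) => k; nia.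
  by rewrite subr0.
rewrite negbK => /eqP d0; rewrite d0 sub0r.
have -> : (d == 0) = false.
  by apply/eqP => d_eq; have := geom_mulrn e_gt0 0; rewrite mulr0n -d_eq d0.
have [/geom_neq0[n /eqP]|/negPn/eqP->] := boolP (geom e (d - e) != 0).
  rewrite subr_eq addrC -mulrS => /eqP d_eq.
  by have := geom_mulrn e_gt0 n.+1; rewrite -d_eq d0.
by rewrite oppr0.
Qed.

Definition gorder k f := forall d, f d != 0 -> k <= deg d.

Lemma gorder0 f : gorder 0 f. Proof. by move=> d /gdeg_ge0. Qed.

Lemma gorder_zero k : gorder k 0. Proof. by move=> d; rewrite gcoef0 eqxx. Qed.

Lemma gorderW k k' f : k' <= k -> gorder k f -> gorder k' f.
Proof. by move=> le fk d /fk; apply: le_trans. Qed.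

Lemma gorderD k f g : gorder k f -> gorder k g -> gorder k (f + g).
Proof.
move=> fk gk d; rewrite gcoefD.
by have [->|/fk] := eqVneq (f d) 0; [rewrite add0r; apply: gk |].
Qed.

Lemma gorderN k f : gorder k f -> gorder k (- f).
Proof. by move=> fk d; rewrite gcoefN oppr_eq0; apply: fk. Qed.

Lemma gorderM k k' f g : gorder k f -> gorder k' g -> gorder (k + k') (f * g).
Proof.
move=> fk gk d /smul_neq0[e /fk ke /gk]; rewrite degreeB => k'e.
by lia.
Qed.

Lemma gorderMl k f g : gorder k g -> gorder k (f * g).
Proof. by rewrite -{2}(add0r k); apply: gorderM; apply: gorder0. Qed.

Lemma gorder_mono k e : k <= deg e -> gorder k (gmono e).
Proof.
move=> ke d /=; case: ifP => _; last by rewrite eqxx.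
by have [->|] := eqVneq d e.
Qed.

(** Congruence modulo the ideal of series in degrees at least [k]. It is compatible with
    determinants and determines the coefficients below degree [k]. *)
Definition gcongr k f g := gorder k (f - g).

Lemma gcongr_refl k f : gcongr k f f.
Proof. by rewrite /gcongr subrr; apply: gorder_zero. Qed.

Lemma gcongr_trans k f g h : gcongr k f g -> gcongr k g h -> gcongr k f h.
Proof. by move=> fg gh; have := gorderD fg gh; rewrite addrA subrK. Qed.

Lemma gcongr_sym k f g : gcongr k f g -> gcongr k g f.
Proof. by move=> /gorderN; rewrite opprB. Qed.

Lemma gcongrD k f f' g g' : gcongr k f f' -> gcongr k g g' ->
  gcongr k (f + g) (f' + g').
Proof. by move=> ff' gg'; rewrite /gcongr opprD addrACA; apply: gorderD. Qed.

Lemma gcongrM k f f' g g' : gcongr k f f' -> gcongr k g g' ->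
  gcongr k (f * g) (f' * g').
Proof.
move=> ff' gg'; rewrite /gcongr.
have -> : f * g - f' * g' = g * (f - f') + f' * (g - g') by ring.
by apply: gorderD; apply: gorderMl.
Qed.

Lemma gcongr_sum k (I : Type) (r : seq I) (P : pred I) (F G : I -> gser D) :
  (forall i, gcongr k (F i) (G i)) ->
  gcongr k (\sum_(i <- r | P i) F i) (\sum_(i <- r | P i) G i).
Proof.
move=> FG; apply: (big_rec2 (gcongr k)); first exact: gcongr_refl.
by move=> i f g _; apply: gcongrD.
Qed.

Lemma gcongr_prod k (I : Type) (r : seq I) (P : pred I) (F G : I -> gser D) :
  (forall i, gcongr k (F i) (G i)) ->
  gcongr k (\prod_(i <- r | P i) F i) (\prod_(i <- r | P i) G i).
Proof.
move=> FG; apply: (big_rec2 (gcongr k)); first exact: gcongr_refl.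
by move=> i f g _; apply: gcongrM.
Qed.

Lemma gcongr_det k n (A B : 'M[gser D]_n) :
  (forall i j, gcongr k (A i j) (B i j)) -> gcongr k (\det A) (\det B).
Proof.
move=> AB; apply: gcongr_sum => s; apply: gcongrM; first exact: gcongr_refl.
by apply: gcongr_prod => i; apply: AB.
Qed.

Lemma gcongr_coef k f g d : gcongr k f g -> deg d < k -> f d = g d.
Proof.
move=> fg; rewrite ltNge => ltd; apply/eqP; rewrite -subr_eq0 -gcoefB.
by apply: contraNT ltd; apply: fg.
Qed.

(* If [f d <> 0], then [f] is nonzero at all [d - e *+ n], which are infinitely
   many exponents of the same degree. *)
Lemma one_minus_mono_regular (P : E -> Prop) e f :
    deg e = 0 -> (forall n, e *+ n = 0 -> n = 0%N) -> (forall d, P d -> P (d - e)) ->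
    (forall d, P d -> ((1 - gmono e) * f) d = 0) ->
  forall d, P d -> f d = 0.
Proof.
move=> dege e_free PB f0 d Pd; apply/eqP; apply: contraT => fd.
have Pn n : P (d - e *+ n).
  by elim: n => [|n IHn]; rewrite ?subr0 // mulrSr opprD addrA; apply: PB.
have fn n : f (d - e *+ n) = f d.
  elim: n => [|n <-]; first by rewrite subr0.
  have /eqP := f0 _ (Pn n); rewrite mulrBl mul1r gcoefB subr_eq0 gcoef_monoM ?dege //.
  by rewrite mulrSr opprD addrA => /eqP.
have [s s_uniq sP] := gser_cover f (deg d).
have : uniq [seq d - e *+ n | n <- iota 0 (size s).+1].
  rewrite map_inj_in_uniq ?iota_uniq // => m n _ _ /addrI/oppr_inj.
  wlog le : m n / (m <= n)%N => [hw emn|].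
    by case: (leqP m n) => [le|/ltnW le]; [|apply/esym]; apply: hw.
  by rewrite -(subnKC le) mulrnDr => /eqP; rewrite -subr_eq0 opprD addrA subrr
    sub0r oppr_eq0 => /eqP/e_free ->; rewrite addn0.
move=> /uniq_leq_size ss; have : (size s < size s)%N.
  have := ss s; rewrite size_map size_iota; apply => _ /mapP[n _ ->].
  apply: sP; rewrite ?fn // degreeB.
  have -> : deg (e *+ n) = 0 by rewrite degreeMn dege mul0r.
  by rewrite subr0.
by rewrite ltnn.
Qed.

End GradedSeriesTheory.

(** * Cauchy's determinant *)

Section CauchyDeterminant.

Variable R : comNzRingType.

Definition pairprod n (F : 'I_n -> 'I_n -> R) : R :=
  \prod_(i < n) \prod_(j < n | (i < j)%N) F i j.

Lemma eq_pairprod n (F G : 'I_n -> 'I_n -> R) :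
  (forall i j : 'I_n, (i < j)%N -> F i j = G i j) -> pairprod F = pairprod G.
Proof. by move=> FG; apply: eq_bigr => i _; apply: eq_bigr => j; apply: FG. Qed.

Lemma pairprodM n (F G : 'I_n -> 'I_n -> R) :
  pairprod (fun i j => F i j * G i j) = pairprod F * pairprod G.
Proof. by rewrite /pairprod -big_split; apply: eq_bigr => i _; rewrite big_split. Qed.

Lemma pairprod_recl n (F : 'I_n.+1 -> 'I_n.+1 -> R) :
  pairprod F = \prod_(j < n) F ord0 (lift ord0 j)
               * pairprod (fun i j => F (lift ord0 i) (lift ord0 j)).
Proof.
rewrite /pairprod big_ord_recl; congr (_ * _).
  by rewrite big_mkcond big_ord_recl /= mul1r.
by apply: eq_bigr => i _; rewrite big_mkcond big_ord_recl /= mul1r -big_mkcond.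
Qed.

Lemma det_scale_rows_cols n (c e : 'I_n -> R) (A : 'M[R]_n) :
  \det (\matrix_(i, j) (c i * A i j * e j)) = \prod_i c i * \prod_j e j * \det A.
Proof.
have -> : \matrix_(i, j) (c i * A i j * e j)
    = diag_mx (\row_i c i) *m A *m diag_mx (\row_j e j).
  by apply/matrixP => i j; rewrite mul_diag_mx mul_mx_diag !mxE.
rewrite !det_mulmx !det_diag mulrAC; congr (_ * _ * _);
  by apply: eq_bigr => i _; rewrite mxE.
Qed.

(* Schur complement of the top left entry, whose inverse is [w00]. *)
Lemma det_schur_complement n (v : 'I_n.+1 -> 'I_n.+1 -> R) w00 :
  v ord0 ord0 * w00 = 1 ->
  \det (\matrix_(i, j) v i j) = v ord0 ord0 *
    \det (\matrix_(i < n, j < n) (v (lift ord0 i) (lift ord0 j)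
            - v (lift ord0 i) ord0 * w00 * v ord0 (lift ord0 j))).
Proof.
move=> vw; pose M : 'M_(1 + n) := \matrix_(i, j) v i j.
have l0 i : lshift n i = ord0 :> 'I_(1 + n) by apply: val_inj; rewrite /= ord1.
have r0 i : rshift 1 i = lift ord0 i :> 'I_(1 + n) by apply: val_inj.
set S := \matrix_(i < n, j < n) (_ - _).
suff detM : \det (M : 'M_(1 + n)) = v ord0 ord0 * \det S by exact: detM.
rewrite -[M in LHS]submxK.
have -> : block_mx (ulsubmx M) (ursubmx M) (dlsubmx M) (drsubmx M)
   = block_mx 1%:M 0 (w00 *: dlsubmx M) 1%:M
     *m block_mx (ulsubmx M) (ursubmx M) 0 S.
  rewrite mulmx_block !mul1mx !mul0mx !addr0; congr block_mx.
    apply/matrixP => i j; rewrite !mxE big_ord1 !mxE !l0 !r0.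
    by rewrite -mulrA mulrCA [w00 * _]mulrC vw mulr1.
  apply/matrixP => i j; rewrite !mxE big_ord1 !mxE !l0 !r0.
  by rewrite [w00 * _]mulrC addrC subrK.
by rewrite det_mulmx det_lblock det_ublock !det1 !mul1r det_mx11 !mxE l0.
Qed.

(* Homogeneous form of Cauchy's determinant: it is needed for 1 / (1 - u x) and
   for 1 / ((1 - u x) (1 - u / x)) = 1 / ((1 + u^2) - u (x + 1/x)). *)
Lemma det_cauchy n (X a b : 'I_n -> R) (v : 'I_n -> 'I_n -> R) :
    (forall i j, v i j * (b j - a j * X i) = 1) ->
  \det (\matrix_(i, j) v i j) = \prod_i \prod_j v i j
    * pairprod (fun i j => X j - X i) * pairprod (fun i j => a j * b i - a i * b j).
Proof.
elim: n X a b v => [|n IHn] X a b v vP.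
  by rewrite det_mx00 /pairprod !big_ord0 !mulr1.
rewrite (det_schur_complement (vP ord0 ord0)).
(* The Schur complement is a Cauchy matrix again, with rows scaled by [c] and columns by [e]. *)
pose c i := v (lift ord0 i) ord0 * (X (lift ord0 i) - X ord0).
pose e j := v ord0 (lift ord0 j) * (a (lift ord0 j) * b ord0 - a ord0 * b (lift ord0 j)).
have -> : \matrix_(i < n, j < n) (v (lift ord0 i) (lift ord0 j)
            - v (lift ord0 i) ord0 * (b ord0 - a ord0 * X ord0) * v ord0 (lift ord0 j))
   = \matrix_(i, j) (c i * (\matrix_(i, j) v (lift ord0 i) (lift ord0 j)) i j * e j).
  apply/matrixP => i j; rewrite !mxE /c /e.
  set i1 := lift ord0 i; set j1 := lift ord0 j.
  (* Inserting factors equal to 1 by [vP] takes the place of a common denominator. *)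
  transitivity (v i1 j1 * (v i1 ord0 * (b ord0 - a ord0 * X i1))
                       * (v ord0 j1 * (b j1 - a j1 * X ord0))
     - v i1 ord0 * (b ord0 - a ord0 * X ord0) * v ord0 j1
       * (v i1 j1 * (b j1 - a j1 * X i1))).
    by rewrite !vP !mulr1.
  by ring.
rewrite det_scale_rows_cols (IHn (X \o lift ord0) (a \o lift ord0) (b \o lift ord0));
  last first.
  by move=> i j; apply: vP.
rewrite !pairprod_recl !big_ord_recl /= /c /e !big_split /=.
have -> : \prod_(i < n) \prod_j v (lift ord0 i) j
   = \prod_(i < n) v (lift ord0 i) ord0
     * \prod_(i < n) \prod_(j < n) v (lift ord0 i) (lift ord0 j).
  by rewrite -big_split; apply: eq_bigr => i _; rewrite big_ord_recl.
by ring.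
Qed.

End CauchyDeterminant.

(** * Comparison of the symplectic kernel with the Cauchy kernel *)

Section SymplecticKernel.

Variables (E : zmodType) (D : {additive E -> int}) (n : nat).
Variables (x u : 'I_n -> E) (xi : 'I_n -> {additive E -> int}).
Local Notation deg := (degree D).
Local Notation G := (gser D).
Implicit Types (d : E) (f g : G).

Hypotheses (deg_x : forall i, deg (x i) = 0) (deg_u : forall j, deg (u j) = 1).
Hypotheses (xi_x : forall k i, degree (xi k) (x i) = (k == i)%:R)
           (xi_u : forall k j, degree (xi k) (u j) = 0).
Hypothesis u_free : forall (i j : 'I_n) k, (i < j)%N -> (u j - u i) *+ k = 0 -> k = 0%N.

Let gx i : G := gmono D (x i).
Let gx' i : G := gmono D (- x i).
Let gu j : G := gmono D (u j).
Let hxu i j : G := ggeom D (x i + u j).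
Let hx'u i j : G := ggeom D (- x i + u j).

Fact deg_nx i : deg (- x i) = 0. Proof. by rewrite degreeN deg_x oppr0. Qed.
Fact gxK i : gx i * gx' i = 1.
Proof. by rewrite -gmonoD ?deg_x ?deg_nx // subrr gmono0. Qed.

Fact hxuK i j : (1 - gx i * gu j) * hxu i j = 1.
Proof.
by rewrite -gmonoD ?deg_x ?deg_u // ggeomK // degreeD deg_x deg_u.
Qed.

Fact hx'uK i j : (1 - gx' i * gu j) * hx'u i j = 1.
Proof.
by rewrite -gmonoD ?deg_nx ?deg_u // ggeomK // degreeD deg_nx deg_u.
Qed.

Definition x_nonneg d := forall k, 0 <= degree (xi k) d.

Definition x_vanishing f := forall d, x_nonneg d -> f d = 0.

Definition cauchy_kernel : G := \prod_i \prod_j hxu i j.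

(** The product K(x,u) A(u) C(1/x). *)
Definition symplectic_kernel : G :=
  \prod_i \prod_j (hxu i j * hx'u i j) * pairprod (fun i j => 1 - gu i * gu j)
  * \prod_(i < n) \prod_(j < n | (i <= j)%N) (1 - gx' i * gx' j).

Let Wx := pairprod (fun i j => gx j - gx i).
Let Wu := pairprod (fun i j => gu j - gu i).

Lemma det_cauchy_kernel : cauchy_kernel * Wx * Wu = \det (\matrix_(i, j) hxu i j).
Proof.
rewrite (@det_cauchy _ n gx gu (fun=> 1)); last first.
  by move=> i j; rewrite mulrC [gu j * _]mulrC hxuK.
by congr (_ * _); apply: eq_pairprod => i j _; rewrite !mulr1.
Qed.

(** Cauchy's determinant with X = x + 1/x, a = u, b = 1 + u^2. The differences of the X_i factor as
    (x_j - x_i)(1 - 1/(x_i x_j)), and those in u as (u_j - u_i)(1 - u_i u_j). The diagonal factors 1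
    - x_i^-2 of C scale the rows and split each entry into partial fractions. *)
Lemma det_symplectic_kernel : symplectic_kernel * Wx * Wu
  = \det (\matrix_(i, j) (hxu i j - gx' i * gx' i * hx'u i j)).
Proof.
pose v i j := hxu i j * hx'u i j.
have vP i j : v i j * ((1 + gu j * gu j) - gu j * (gx i + gx' i)) = 1.
  rewrite /v; transitivity (((1 - gx i * gu j) * hxu i j) * ((1 - gx' i * gu j) * hx'u i j)
    + (1 - gx i * gx' i) * gu j * gu j * hxu i j * hx'u i j); first by ring.
  by rewrite hxuK hx'uK gxK subrr !mul0r mulr1 addr0.
have -> : \matrix_(i, j) (hxu i j - gx' i * gx' i * hx'u i j)
    = \matrix_(i, j) ((1 - gx' i * gx' i) * (\matrix_(i, j) v i j) i j * 1).
  apply/matrixP => i j; rewrite !mxE mulr1.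
  transitivity (hxu i j * ((1 - gx' i * gu j) * hx'u i j)
    - gx' i * gx' i * hx'u i j * ((1 - gx i * gu j) * hxu i j)).
    by rewrite hxuK hx'uK !mulr1.
  rewrite /v; transitivity ((1 - gx' i * gx' i) * (hxu i j * hx'u i j)
    - (1 - gx i * gx' i) * gx' i * gu j * hxu i j * hx'u i j); first by ring.
  by rewrite gxK subrr !mul0r subr0.
rewrite det_scale_rows_cols (det_cauchy vP) big1_eq mulr1.
have -> : pairprod (fun i j => gx j + gx' j - (gx i + gx' i))
    = Wx * pairprod (fun i j => 1 - gx' i * gx' j).
  rewrite -pairprodM; apply: eq_pairprod => i j _.
  transitivity ((gx j - gx i) * (1 - gx' i * gx' j) + (1 - gx i * gx' i) * gx' j
     - (1 - gx j * gx' j) * gx' i); first by ring.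
  by rewrite !gxK subrr !mul0r subr0 addr0.
have -> : pairprod (fun i j => gu j * (1 + gu i * gu i) - gu i * (1 + gu j * gu j))
    = Wu * pairprod (fun i j => 1 - gu i * gu j).
  by rewrite -pairprodM; apply: eq_pairprod => i j _; ring.
rewrite /symplectic_kernel.
have -> : \prod_(i < n) \prod_(j < n | (i <= j)%N) (1 - gx' i * gx' j)
    = \prod_i (1 - gx' i * gx' i) * pairprod (fun i j => 1 - gx' i * gx' j) :> G.
  rewrite -big_split; apply: eq_bigr => i _; rewrite (bigD1 i) //=; congr (_ * _).
  by apply: eq_bigl => j; rewrite ltn_neqAle andbC -val_eqE eq_sym.
by rewrite /v; ring.
Qed.

Definition x_degree0 k f := forall d, f d != 0 -> degree (xi k) d = 0.

Lemma x_degree0M k f g : x_degree0 k f -> x_degree0 k g -> x_degree0 k (f * g).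
Proof.
move=> f0 g0 d /smul_neq0[e /f0 fe /g0]; rewrite degreeB fe subr0; exact.
Qed.

Fact x_degree0_hxu k i j : k != i -> x_degree0 k (hxu i j).
Proof.
move=> neq d; rewrite gcoef_geom ?degreeD ?deg_x ?deg_u // => /geom_neq0[t ->].
by rewrite degreeMn degreeD xi_x xi_u (negbTE neq) mul0r.
Qed.

Let neg_term i j : G := gx' i * gx' i * hx'u i j.

Fact neg_termE i j d : neg_term i j d != 0 ->
  exists t, d = - (x i *+ 2) + (- x i + u j) *+ t.
Proof.
rewrite /neg_term -gmonoD ?deg_nx // gcoef_monoM ?degreeD ?deg_nx //.
rewrite gcoef_geom ?degreeD ?deg_nx ?deg_u // => /geom_neq0[t dE].
by exists t; rewrite -dE mulr2n opprD addrC subrK.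
Qed.

Fact xi_neg_term k i j d : neg_term i j d != 0 ->
  if k == i then degree (xi k) d < 0 else degree (xi k) d == 0.
Proof.
case/neg_termE => t ->; rewrite degreeD degreeN !degreeMn degreeD degreeN xi_x xi_u.
case: eqP => _; last by rewrite mul0r oppr0 add0r mul0r.
by rewrite addr0; lia.
Qed.

(* A product in the expansion that takes the subtracted term in row i has a
   negative exponent of x_i, since no other row contains x_i. *)
Lemma x_vanishing_det :
  x_vanishing (\det (\matrix_(i, j) (hxu i j - neg_term i j))
                - \det (\matrix_(i, j) hxu i j)).
Proof.
move=> d dP; rewrite -sumrB gcoef_sum big1 // => s _; rewrite -mulrBr.
have sub0 (f : G) : f d = 0 -> ((-1) ^+ s * f) d = 0.
  by rewrite mulr_sign; case: ifP => // _; rewrite gcoefN => ->; rewrite oppr0.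
apply: sub0; under eq_bigr => i _ do rewrite mxE.
under [X in _ - X]eq_bigr => i _ do rewrite mxE.
(* The set [J] consists of the rows that take the term [hxu]; the full set yields the second
   determinant. *)
rewrite bigA_distr (bigD1 [set: 'I_n]%SET) //=.
have -> : \prod_i (if i \in [set: 'I_n]%SET then hxu i (s i) else - neg_term i (s i))
    = \prod_i hxu i (s i) by apply: eq_bigr => i _; rewrite finset.in_setT.
rewrite addrAC subrr add0r gcoef_sum big1 // => J J_neqT.
have [k kJ] : exists k, k \notin J.
  by apply/existsP; rewrite -negb_forall; apply: contra J_neqT => /forallP JT;
     apply/eqP/setP => i; rewrite JT finset.in_setT.
apply/eqP; apply: contraT; rewrite (bigD1 k) //= (negbTE kJ).
case/smul_neq0 => e; rewrite gcoefN oppr_eq0 => /(xi_neg_term k).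
rewrite eqxx => e_lt0 rest.
suff : x_degree0 k (\prod_(i < n | i != k)
    (if i \in J then hxu i (s i) else - neg_term i (s i))).
  by move=> /(_ _ rest); rewrite degreeB; have := dP k; lia.
apply: (big_ind (x_degree0 k)) => [d'|f g|i nik].
- by rewrite gcoef1; have [->|] := eqVneq d' 0; rewrite ?degree0.
- exact: x_degree0M.
case: ifP => _; first by apply: x_degree0_hxu; rewrite eq_sym.
move=> d'; rewrite gcoefN oppr_eq0 => /(xi_neg_term k).
by rewrite eq_sym (negbTE nik) => /eqP.
Qed.

(** Up to the monomial u_i and a sign, the factor is 1 - u_j / u_i. Its exponent has degree 0, is
    not torsion and does not involve x, so regularity applies along the exponents that are
    nonnegative in x. *)
Fact x_vanishing_cancel f (i j : 'I_n) : (i < j)%N ->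
  x_vanishing (f * (gu j - gu i)) -> x_vanishing f.
Proof.
move=> ltij; have du : deg (u j - u i) = 0 by rewrite degreeB !deg_u subrr.
have -> : f * (gu j - gu i) = - (gu i * ((1 - gmono D (u j - u i)) * f)).
  have -> : gu j = gmono D (u j - u i) * gu i by rewrite -gmonoD ?du ?deg_u // subrK.
  by ring.
move=> f0; apply: (one_minus_mono_regular (P := x_nonneg) du).
- by move=> k; apply: u_free.
- by move=> d dP k; rewrite !degreeB !xi_u !subr0.
move=> d dP; have : x_nonneg (d + u i) by move=> k; rewrite degreeD xi_u addr0.
move/f0; rewrite gcoefN gcoef_monoM ?deg_u // addrK => /eqP.
by rewrite oppr_eq0 => /eqP.
Qed.

(** [Wu] is free of x and cancels factor by factor. [Wx] shifts the exponents of x, so it is not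
    removed in this way; it will be matched with V(x). *)
Lemma symplectic_kernelP : x_vanishing ((symplectic_kernel - cauchy_kernel) * Wx).
Proof.
have : x_vanishing ((symplectic_kernel - cauchy_kernel) * Wx * Wu).
  rewrite !mulrBl det_cauchy_kernel det_symplectic_kernel; exact: x_vanishing_det.
have cancelW : forall f, x_vanishing (f * Wu) -> x_vanishing f.
  pose K c := forall f, x_vanishing (f * c) -> x_vanishing f.
  have K1 : K 1 by move=> f; rewrite mulr1.
  have KM c c' : K c -> K c' -> K (c * c').
    by move=> Kc Kc' f; rewrite mulrA => /Kc'/Kc.
  apply: (big_ind K) => // i _; apply: (big_ind K) => // j ltij f.
  exact: x_vanishing_cancel.
exact: cancelW.
Qed.

Lemma x_vanishingM f g : x_vanishing f -> (forall k, x_degree0 k g) ->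
  x_vanishing (f * g).
Proof.
move=> f0 g0 d dP; apply/eqP; apply: contraT => /smul_neq0[e fe ge].
case/eqP: fe; apply: f0 => k; have := g0 k _ ge; rewrite degreeB.
by have := dP k; lia.
Qed.

End SymplecticKernel.

(** * The Cauchy identity for truncated series *)

Section TruncatedCauchy.

Variable R : comNzRingType.
Hypothesis R_no2 : forall x : R, x = - x -> x = 0.

Lemma mem_boxed_partsP B (la : intpart) :
  (la \in boxed_parts B) = (size la <= B)%N && all (leq^~ B) la.
Proof.
apply/idP/andP => [|[sla /allP leB]]; last exact: mem_boxed_parts.
rewrite mem_pmap_sub => /mapP[s _ ->]; rewrite size_map size_bseq; split=> //.
by apply/allP => _ /mapP[k _ ->]; rewrite -ltnS ltn_ord.
Qed.

Section Determinant.

Variables (n M : nat) (a : nat -> 'I_n -> R).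

Let T : {mpoly R[n]} :=
  \det (\matrix_(i < n, j < n) \sum_(k < M) (a k j)%:MP * mvar R i ^+ k).

(** X_i occurs in row i only, so the monomial X^m selects the summand k = m_i of that row. *)
Lemma mcoeff_det_series m : T@_m =
  if [forall i, m i < M]%N then \det (\matrix_(i < n, j < n) a (m i) j) else 0.
Proof.
have TE : T = \sum_(s : 'S_n) (-1) ^+ s *
    \sum_(f : {ffun 'I_n -> 'I_M}) ((\prod_i a (f i) (s i))%:MP
                                            * 'X_[[multinom (f i : nat) | i < n]]).
  apply: eq_bigr => s _; congr (_ * _); under eq_bigr => i _ do rewrite mxE.
  rewrite bigA_distr_bigA; apply: eq_bigr => f _.
  rewrite big_split /= -rmorph_prod mpolyXE_id; congr (_ * _); apply: eq_bigr => i _.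
  by rewrite mnmE.
rewrite TE raddf_sum /=; case: ifPn => [/forallP ltM|].
  apply: eq_bigr => s _; rewrite mcoeff_signM; congr (_ * _).
  rewrite raddf_sum /= (bigD1 [ffun i => Ordinal (ltM i)]) //= [X in _ + X]big1 ?addr0.
    rewrite mcoeffCM mcoeffX.
    have -> : [multinom ([ffun i => Ordinal (ltM i)] i : nat) | i < n] = m.
      by apply/mnmP => i; rewrite mnmE ffunE.
    by rewrite eqxx mulr1; apply: eq_bigr => i _; rewrite mxE ffunE.
  move=> f neq; rewrite mcoeffCM mcoeffX; case: eqP; rewrite ?mulr0 // => mE.
  case/eqP: neq; apply/ffunP => i; apply: val_inj; rewrite ffunE /= -mE.
  by rewrite mnmE.
rewrite negb_forall => /existsP[i0 geM]; apply: big1 => s _.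
rewrite mcoeff_signM raddf_sum /= [X in _ * X]big1 ?mulr0 // => f _.
rewrite mcoeffCM mcoeffX; case: eqP; rewrite ?mulr0 // => mE.
by rewrite -mE mnmE ltn_ord in geM.
Qed.

Lemma alternating_det_series : alternating T.
Proof.
move=> s; rewrite /T -[LHS]det_map_mx -det_perm -det_mulmx -row_permE.
congr (\det _); apply/matrixP => i j; rewrite !mxE raddf_sum /=.
apply: eq_bigr => k _; rewrite msymM; congr (_ * _); first exact: mmapC.
rewrite rmorphXn; congr (_ ^+ _); rewrite /= msymX; congr 'X_[_].
by apply/mnmP => l; rewrite !mnmE -(inj_eq (@perm_inj _ s)) permKV.
Qed.

End Determinant.

(** With indeterminates in place of [x] the determinant is alternating, and its coefficient at la +
    rho is the Jacobi-Trudi determinant of [la] in [s]. The expansion in alternants is then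
    evaluated at [x]. *)
Lemma det_complete_expand n B (x : 'I_n -> R) (s : seq R) : (n <= B)%N ->
  \det (\matrix_(i < n, j < n) \sum_(k < B + n) hsym_sub s k (n.-1 - j) * x i ^+ k)
  = (\sum_(la <- boxed_parts B) spoly (codom x) la * spoly s la)
    * alt x (shifted n [::]).
Proof.
move=> leB; pose a k (j : 'I_n) := hsym_sub s k (n.-1 - j).
have coefE (la : intpart) : (size la <= n)%N ->
    (\det (\matrix_(i < n, j < n)
        \sum_(k < B + n) (a k j)%:MP * mvar R i ^+ k))@_(mshifted n la)
    = if la \in boxed_parts B then spoly s la else 0.
  move=> lela; rewrite mcoeff_det_series -(spoly_jt s lela).
  (* The largest entry of la + rho is la_0 + n - 1, so the bound B + n says exactly that the parts
     are at most [B]; n <= B takes care of the length. *)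
  have -> : [forall i, mshifted n la i < B + n]%N = (la \in boxed_parts B).
    rewrite mem_boxed_partsP (leq_trans lela leB).
    apply/forallP/allP => [ltM k /(nthP 0%N)[i lti <-]|leM i].
      have lt0n : (0 < n)%N := leq_ltn_trans (leq0n i) (leq_trans lti lela).
      have := ltM (Ordinal lt0n); rewrite mnmE /shifted subn0.
      have : (nth 0 la i <= nth 0 la 0)%N; last by rewrite /=; lia.
      have geq_trans : transitive geq by move=> ? ? ? /= ? ?; lia.
      have := sorted_leq_nth geq_trans _ 0%N (intpart_sorted la).
      by apply; rewrite ?inE // ?(leq_ltn_trans _ lti) // => ? /=.
    rewrite mnmE /shifted; have lti := ltn_ord i.
    have [ltil|leil] := ltnP i (size la); last by rewrite nth_default //; lia.
    by have := leM _ (mem_nth 0%N ltil) => /=; lia.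
  case: ifP => // _; congr (\det _); apply/matrixP => i j.
  by rewrite !mxE mnmE.
have QP (la : intpart) : (size la <= n)%N ->
    (\det (\matrix_(i < n, j < n)
        \sum_(k < B + n) (a k j)%:MP * mvar R i ^+ k))@_(mshifted n la)
    != 0 -> la \in boxed_parts B.
  by move=> lela; rewrite coefE //; case: ifP; rewrite ?eqxx.
have eqT := alternating_expand R_no2 (alternating_det_series (B + n) a)
  (uniq_boxed_parts B) QP.
have := congr1 (meval x) eqT; rewrite -det_map_mx raddf_sum /=.
have evX i : meval x (mvar R i) = x i by rewrite mevalXU.
set lhs := \det _; set lhs' := \det _ => eqs.
transitivity lhs.
  congr (\det _); apply/matrixP => i j; rewrite !mxE raddf_sum /=.
  by apply: eq_bigr => k _; rewrite mevalM mevalC rmorphXn /= evX.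
rewrite eqs mulr_suml [LHS]big_mkcond [LHS]big_seq [RHS]big_seq.
apply: eq_bigr => la laQ; case: ifPn => [lela|]; last first.
  by rewrite -ltnNge => lt; rewrite spoly_eq0 ?size_codom ?card_ord // !mul0r.
rewrite mevalZ coefE // laQ -alt_map mulrAC -alt_spoly // mulrC; congr (_ * _).
by congr (\det _); apply/matrixP => i j; rewrite !mxE /= evX.
Qed.

End TruncatedCauchy.

Arguments hsym : simpl never.

(** * The Cauchy identity for graded series *)

Section GradedCauchy.

Variables (E : zmodType) (D : {additive E -> int}).
Local Notation deg := (degree D).
Implicit Types (d e : E) (f g : gser D).

Lemma gser_no2 f : f = - f -> f = 0.
Proof.
move=> ef; apply: gserP => d; have := congr1 (fun h : gser D => h d) ef.
by rewrite gcoefN gcoef0; lia.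
Qed.

Lemma gorder_hsym (s : seq (gser D)) k : (forall v, v \in s -> gorder 1 v) ->
  gorder k%:Z (hsym s k).
Proof.
elim: s k => [|v s IHs] k sP; first by case: k => [|k]; [exact: gorder0 | exact: gorder_zero].
have {}IHs l : gorder l%:Z (hsym s l).
  by apply: IHs => w ws; apply: sP; rewrite inE ws orbT.
elim: k => [|k IHk]; first exact: gorder0.
rewrite hsym_consS; apply: gorderD => //; rewrite -add1n PoszD.
by apply: gorderM => //; apply: sP; rewrite inE eqxx.
Qed.

(** The powers of [w] may all have degree 0; the truncation is controlled by h_k, which has order at
    least k because the members of [us] have degree at least 1. *)
Lemma hsym_series_congr (w : E) (us : seq E) L :
  0 <= deg w -> (forall e, e \in us -> 1 <= deg e) ->
  gcongr L%:Z (\sum_(k < L) hsym (map (gmono D) us) k * gmono D w ^+ k)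
              (\prod_(e <- us) ggeom D (w + e)).
Proof.
move=> w0; elim: us => [|e us IHus] usP.
  rewrite big_nil; case: L => [|L]; first exact: gorder0.
  rewrite big_ord_recl big1 ?addr0; last by move=> k _; rewrite /= mul0r.
  by rewrite expr0 mulr1 hsym0; apply: gcongr_refl.
have {}IHus := IHus (fun e' h => usP e' (mem_behead (s := e :: us) h)).
have e1 : 1 <= deg e by apply: usP; rewrite inE eqxx.
have e0 : 0 <= deg e by apply: le_trans e1.
have we0 : 0 < deg (w + e) by rewrite degreeD; lia.
rewrite big_cons /=; set v := gmono D e; set x := gmono D w.
set s := map _ us; set H := \sum_(k < L) _.
have -> : H = ggeom D (w + e) * ((1 - x * v) * H).
  by rewrite mulrA [ggeom _ _ * _]mulrC -gmonoD // ggeomK // mul1r.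
apply: gcongrM; first exact: gcongr_refl.
apply: gcongr_trans IHus; rewrite /H {H we0}; case: L => [|L]; first exact: gorder0.
(* The factor 1 - x v removes [v] from the list, up to a boundary term of order at least L + 1. *)
have -> : (1 - x * v) * (\sum_(k < L.+1) hsym (v :: s) k * x ^+ k)
    = \sum_(k < L.+1) hsym s k * x ^+ k - v * hsym (v :: s) L * x ^+ L.+1.
  elim: L => [|L IHL].
    by rewrite !big_ord_recl !big_ord0 !hsym0 !addr0; ring.
  rewrite big_ord_recr mulrDr IHL [in RHS]big_ord_recr /= hsym_consS !exprS.
  by ring.
rewrite -[X in gcongr _ _ X]addr0 -oppr0; apply: gcongrD; first exact: gcongr_refl.
rewrite /gcongr opprK addr0; apply: gorderN.
rewrite -[_%:Z]addr0; apply: gorderM; last exact: gorder0.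
rewrite -add1n PoszD; apply: gorderM; first exact: gorder_mono.
apply: gorder_hsym => y; rewrite inE => /orP[/eqP->|]; first exact: gorder_mono.
case/mapP=> e' e'us ->; apply: gorder_mono.
by apply: usP; rewrite inE e'us orbT.
Qed.

Lemma hsym_sub_series_congr (w : E) (us : seq E) b L :
  0 <= deg w -> (forall e, e \in us -> 1 <= deg e) ->
  gcongr L%:Z
    (\sum_(k < b + L) hsym_sub (map (gmono D) us) k b * gmono D w ^+ k)
    (gmono D w ^+ b * \prod_(e <- us) ggeom D (w + e)).
Proof.
move=> w0 usP; rewrite big_split_ord /= big1 ?add0r; last first.
  by move=> i _; rewrite hsym_sub0 ?mul0r.
have -> : \sum_(i < L) hsym_sub (map (gmono D) us) (b + i) b * gmono D w ^+ (b + i)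
   = gmono D w ^+ b * \sum_(k < L) hsym (map (gmono D) us) k * gmono D w ^+ k.
  rewrite mulr_sumr; apply: eq_bigr => i _.
  by rewrite /hsym_sub leq_addr addKn exprD mulrCA.
by apply: gcongrM; [exact: gcongr_refl | exact: hsym_series_congr].
Qed.

(** The product over [us] is absorbed into the rows of the alternant; each entry is then congruent
    to a truncated series in complete functions, which [det_complete_expand] evaluates. *)
Lemma cauchy_identity n (w : 'I_n -> E) (us : seq E) B :
    (forall i, 0 <= deg (w i)) -> (forall e, e \in us -> 1 <= deg e) -> (n <= B)%N ->
  let x i := gmono D (w i) in
  gcongr B%:Z
    (\prod_i \prod_(e <- us) ggeom D (w i + e) * alt x (shifted n [::]))
    ((\sum_(la <- boxed_parts B)
        spoly (codom x) la * spoly (map (gmono D) us) la) * alt x (shifted n [::])).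
Proof.
move=> w0 usP leB x; rewrite -(det_complete_expand gser_no2) //.
apply: gcongr_sym.
have -> : \prod_i \prod_(e <- us) ggeom D (w i + e) * alt x (shifted n [::])
   = \det (\matrix_(i < n, j < n) (x i ^+ (n.-1 - j) * \prod_(e <- us) ggeom D (w i + e))).
  have := det_scale_rows_cols (fun i => \prod_(e <- us) ggeom D (w i + e)) (fun=> 1)
            (\matrix_(i < n, j < n) x i ^+ shifted n [::] j).
  rewrite big1_eq mulr1 => <-; congr (\det _); apply/matrixP => i j.
  by rewrite !mxE /shifted nth_nil mulr1 mulrC.
apply: gcongr_det => i j; rewrite !mxE.
have ltj := ltn_ord j.
(* The series in column j starts at the power n - 1 - j, which leaves B + 1 + j terms, enough for a
   congruence modulo degree [B]. *)
have -> : (B + n = (n.-1 - j) + (B + n - (n.-1 - j)))%N by lia.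
have := hsym_sub_series_congr (b := (n.-1 - j)%N) (L := (B + n - (n.-1 - j))%N) (w0 i) usP.
by apply: gorderW; lia.
Qed.

End GradedCauchy.

(** * Vandermonde products as alternants *)

Section Vandermonde.

Variable R : comNzRingType.

Lemma alt_rho_pairprod n (u : 'I_n -> R) :
  alt u (shifted n [::]) = pairprod (fun i j => u i - u j).
Proof.
pose A := \matrix_(i < n, j < n) u i ^+ (n.-1 - j).
have -> : alt u (shifted n [::]) = \det A.
  by congr (\det _); apply/matrixP => i j; rewrite !mxE /shifted nth_nil.
(* Reversing rows and columns together costs no sign and turns the decreasing exponents into the
   increasing ones of [Vandermonde]. *)
pose s : 'S_n := perm (@rev_ord_inj n).
have -> : \det A = \det (Vandermonde n (\row_j u (rev_ord j))).
  have -> : Vandermonde n (\row_j u (rev_ord j)) = row_perm s (col_perm s A^T).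
    apply/matrixP => i j; rewrite !mxE !permE; congr (_ ^+ _) => /=.
    by have := ltn_ord i; lia.
  rewrite row_permE col_permE !det_mulmx !det_perm det_tr odd_permV.
  by rewrite [\det _ * _]mulrC signrMK.
rewrite det_Vandermonde /pairprod.
rewrite (reindex_inj rev_ord_inj) /=.
under eq_bigr => i _ do rewrite (reindex_inj rev_ord_inj) /=.
rewrite (exchange_big_dep xpredT) //=; apply: eq_bigr => i _.
apply: eq_big => [j|j _]; last by rewrite !mxE !rev_ordK.
by have := ltn_ord i; have := ltn_ord j; lia.
Qed.

Lemma pairprod_const_row n (c : 'I_n -> R) :
  pairprod (fun i _ => c i) = \prod_i c i ^+ (n.-1 - i).
Proof.
elim: n c => [|n IHn] c; first by rewrite /pairprod !big_ord0.
rewrite pairprod_recl IHn big_ord_recl prodr_const card_ord subn0; congr (_ * _).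
by apply: eq_bigr => i _; congr (_ ^+ _); rewrite /= /bump; have := ltn_ord i; lia.
Qed.

End Vandermonde.

(** V is a_rho divided by the monomial of exponent rho: index i is the smaller one in n - 1 - i
    pairs, each of which receives a factor h_i. *)
Lemma mulr_gmono_pairprod (E : zmodType) (D : {additive E -> int}) n (h : 'I_n -> E) c :
    0 <= c -> (forall i, degree D (h i) = c) ->
  gmono D (\sum_i h i *+ (n.-1 - i)) * pairprod (fun i j => 1 - gmono D (- h i + h j))
    = alt (fun i => gmono D (h i)) (shifted n [::]).
Proof.
move=> c0 hc; rewrite gmono_sum; last by move=> i; rewrite degreeMn hc mulr_ge0.
under eq_bigr => i _ do rewrite gmonoXn ?hc //.
rewrite -pairprod_const_row -pairprodM alt_rho_pairprod; apply: eq_pairprod => i j _.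
rewrite mulrBr mulr1 -gmonoD ?hc // ?degreeD ?degreeN ?hc ?addNr //.
by rewrite addrA subrr add0r.
Qed.

(** * Polynomials evaluated at monomials *)

Section BlockEvaluation.

Variables (E : zmodType) (D : {additive E -> int}).

Definition block_eval n (h : 'I_n -> E) : {mpoly int[n]} -> gser D :=
  mmap intr (fun i => gmono D (h i)).

HB.instance Definition _ n (h : 'I_n -> E) := GRing.RMorphism.on (block_eval h).

Definition block_expo n (h : 'I_n -> E) (m : 'X_{1..n}) : E := \sum_i h i *+ m i.

Lemma block_evalE n (h : 'I_n -> E) f : (forall i, 0 <= degree D (h i)) ->
  block_eval h f = \sum_(m <- msupp f) gmono D (block_expo h m) *~ f@_m.
Proof.
move=> h0; apply: eq_bigr => m _; rewrite mulrzl gmono_sum.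
  by congr (_ *~ _); apply: eq_bigr => i _; rewrite gmonoXn.
by move=> i; rewrite degreeMn mulr_ge0.
Qed.

Lemma block_eval_svar n (h : 'I_n -> E) (la : intpart) :
  block_eval h (svar n la) = spoly (codom (fun i => gmono D (h i))) la.
Proof.
rewrite -[LHS]spoly_map /codom -map_comp; congr spoly; apply: eq_map => i /=.
by rewrite /block_eval mmapX mmap1U.
Qed.

Lemma block_eval_rho_alt n (h : 'I_n -> E) :
  block_eval h (rho_alt n) = alt (fun i => gmono D (h i)) (shifted n [::]).
Proof.
rewrite -[LHS]alt_map; congr (\det _); apply/matrixP => i j; rewrite !mxE /=.
by rewrite /block_eval mmapX mmap1U.
Qed.

Lemma sum_msupp_eq n (f : {mpoly int[n]}) m : \sum_(k <- msupp f) (m == k)%:R * f@_k = f@_m.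
Proof.
have [mf|mNf] := boolP (m \in msupp f).
  rewrite (bigD1_seq m) ?msupp_uniq //= eqxx mul1r big1 ?addr0 // => k.
  by rewrite eq_sym => /negbTE->; rewrite mul0r.
rewrite big1_seq ?(memN_msupp_eq0 mNf) // => k /andP[_ kf].
by case: eqP kf => [<-|]; rewrite ?mul0r // (negbTE mNf).
Qed.

(** By injectivity each exponent arises from only one triple of monomials, so the coefficient
    factors. *)
Lemma coef_block_evalM3 n1 n2 n3 (h1 : 'I_n1 -> E) (h2 : 'I_n2 -> E) (h3 : 'I_n3 -> E)
    f1 f2 f3 m1 m2 m3 :
    (forall i, 0 <= degree D (h1 i)) -> (forall i, 0 <= degree D (h2 i)) ->
    (forall i, 0 <= degree D (h3 i)) ->
    (forall k1 k2 k3 l1 l2 l3,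
       block_expo h1 k1 + block_expo h2 k2 + block_expo h3 k3
         = block_expo h1 l1 + block_expo h2 l2 + block_expo h3 l3 ->
       [/\ k1 = l1, k2 = l2 & k3 = l3]) ->
  (block_eval h1 f1 * block_eval h2 f2 * block_eval h3 f3)
    (block_expo h1 m1 + block_expo h2 m2 + block_expo h3 m3)
  = f1@_m1 * f2@_m2 * f3@_m3.
Proof.
move=> h1P h2P h3P inj; rewrite !block_evalE //.
have expo0 n (h : 'I_n -> E) m :
    (forall i, 0 <= degree D (h i)) -> 0 <= degree D (block_expo h m).
  move=> hP; rewrite /degree raddf_sum; apply: sumr_ge0 => i _.
  by rewrite -/(degree D _) degreeMn mulr_ge0.
rewrite -(sum_msupp_eq f1) -(sum_msupp_eq f2) -(sum_msupp_eq f3).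
rewrite !mulr_suml gcoef_sum; apply: eq_bigr => k1 _.
rewrite mulr_sumr gcoef_sum [RHS]mulr_sumr; apply: eq_bigr => k3 _.
rewrite mulr_sumr mulr_suml gcoef_sum [_ * \sum_(k2 <- _) _]mulr_sumr [RHS]mulr_suml.
apply: eq_bigr => k2 _.
rewrite !(mulrzAl, mulrzAr) !gcoefMz -!gmonoD ?degreeD ?addr_ge0 ?expo0 //.
rewrite gcoef_mono ?degreeD ?addr_ge0 ?expo0 //.
have -> : (block_expo h1 m1 + block_expo h2 m2 + block_expo h3 m3
   == block_expo h1 k1 + block_expo h2 k2 + block_expo h3 k3)
   = [&& m1 == k1, m2 == k2 & m3 == k3].
  by apply/eqP/and3P => [/inj[-> -> ->]|[/eqP-> /eqP-> /eqP->]].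
by case: (m1 == k1); case: (m2 == k2); case: (m3 == k3);
  rewrite ?mul0r ?mulr0 ?mul0r // !mul1r; ring.
Qed.

End BlockEvaluation.

(** * Coordinates of exponents and the grading by y and z *)

Section ExponentCoordinates.

Variables r p q : nat.
Local Notation E := (expo r p q).
Implicit Types d e : E.

Definition xcoord (i : 'I_r) d : int := d.1.1 0 i.
Definition ycoord (a : 'I_p) d : int := d.1.2 0 a.
Definition zcoord (c : 'I_q) d : int := d.2 0 c.
(** The x_i occur with both signs and get degree 0; every ratio of a geometric series in K then has
    degree 1. *)
Definition yzdeg d : int := \sum_a ycoord a d + \sum_c zcoord c d.

Fact xcoord_is_zmod_morphism i : zmod_morphism (xcoord i).
Proof. by move=> d e; rewrite /xcoord !mxE. Qed.
Fact ycoord_is_zmod_morphism a : zmod_morphism (ycoord a).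
Proof. by move=> d e; rewrite /ycoord !mxE. Qed.
Fact zcoord_is_zmod_morphism c : zmod_morphism (zcoord c).
Proof. by move=> d e; rewrite /zcoord !mxE. Qed.

HB.instance Definition _ i :=
  GRing.isZmodMorphism.Build E int (xcoord i) (xcoord_is_zmod_morphism i).
HB.instance Definition _ a :=
  GRing.isZmodMorphism.Build E int (ycoord a) (ycoord_is_zmod_morphism a).
HB.instance Definition _ c :=
  GRing.isZmodMorphism.Build E int (zcoord c) (zcoord_is_zmod_morphism c).

Fact yzdeg_is_zmod_morphism : zmod_morphism yzdeg.
Proof.
move=> d e; rewrite /yzdeg.
under eq_bigr => a _ do rewrite raddfB; under [X in _ + X]eq_bigr => c _ do rewrite raddfB.
by rewrite !sumrB opprD addrACA.
Qed.

HB.instance Definition _ := GRing.isZmodMorphism.Build E int yzdeg yzdeg_is_zmod_morphism.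

Lemma expoP d e : (forall i, xcoord i d = xcoord i e) ->
  (forall a, ycoord a d = ycoord a e) -> (forall c, zcoord c d = zcoord c e) -> d = e.
Proof.
case: d e => [[x y] z] [[x' y'] z'] hx hy hz.
by congr (_, _, _); apply/rowP.
Qed.

Lemma xcoordE : (forall i j, xcoord i (xv p q j) = (i == j)%:R)
  * (forall i a, xcoord i (yv r q a) = 0) * (forall i c, xcoord i (zv r p c) = 0).
Proof. by split; [split|] => i j; rewrite /xcoord mxE. Qed.

Lemma ycoordE : (forall a i, ycoord a (xv p q i) = 0)
  * (forall a b, ycoord a (yv r q b) = (a == b)%:R) * (forall a c, ycoord a (zv r p c) = 0).
Proof. by split; [split|] => i j; rewrite /ycoord mxE. Qed.

Lemma zcoordE : (forall c i, zcoord c (xv p q i) = 0)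
  * (forall c a, zcoord c (yv r q a) = 0) * (forall c c', zcoord c (zv r p c') = (c == c')%:R).
Proof. by split; [split|] => i j; rewrite /zcoord mxE. Qed.

Lemma sum_delta n (j : 'I_n) (F : 'I_n -> int) : \sum_i (i == j)%:R * F i = F j.
Proof.
rewrite (bigD1 j) //= eqxx mul1r big1 ?addr0 // => i /negbTE->.
by rewrite mul0r.
Qed.

Lemma yzdegE : (forall i, yzdeg (xv p q i) = 0)
  * (forall a, yzdeg (yv r q a) = 1) * (forall c, yzdeg (zv r p c) = 1).
Proof.
split; [split|] => i; rewrite /yzdeg.
- by rewrite !big1 // => j _; rewrite ?ycoordE ?zcoordE.
- rewrite [X in _ + X]big1 => [|j _]; last by rewrite zcoordE.
  by rewrite addr0 -[RHS](sum_delta i (fun=> 1)); apply: eq_bigr => j _; rewrite ycoordE mulr1.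
rewrite big1 => [|j _]; last by rewrite ycoordE.
by rewrite add0r -[RHS](sum_delta i (fun=> 1)); apply: eq_bigr => j _; rewrite zcoordE mulr1.
Qed.

Lemma block_expo_coord (f : {additive E -> int}) n (h : 'I_n -> E) m :
  f (block_expo h m) = \sum_i f (h i) * (m i)%:R.
Proof. by rewrite raddf_sum; apply: eq_bigr => i _; rewrite raddfMn mulr_natr. Qed.

Definition xyz_expo (k : 'X_{1..r}) (l : 'X_{1..p}) (m : 'X_{1..q}) : E :=
  block_expo (@xv r p q) k + block_expo (@yv r p q) l + block_expo (@zv r p q) m.

Lemma xyz_expoE k l m : (forall i, xcoord i (xyz_expo k l m) = (k i)%:R)
  * (forall a, ycoord a (xyz_expo k l m) = (l a)%:R)
  * (forall c, zcoord c (xyz_expo k l m) = (m c)%:R).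
Proof.
split; [split|] => i; rewrite !raddfD !block_expo_coord /=.
- rewrite [X in _ + X + _]big1 => [|j _]; last by rewrite xcoordE mul0r.
  rewrite [X in _ + X]big1 => [|j _]; last by rewrite xcoordE mul0r.
  rewrite !addr0 -[RHS](sum_delta i (fun j => (k j)%:R)); apply: eq_bigr => j _.
  by rewrite xcoordE eq_sym.
- rewrite [X in X + _ + _]big1 => [|j _]; last by rewrite ycoordE mul0r.
  rewrite [X in _ + X]big1 => [|j _]; last by rewrite ycoordE mul0r.
  rewrite add0r addr0 -[RHS](sum_delta i (fun j => (l j)%:R)); apply: eq_bigr => j _.
  by rewrite ycoordE eq_sym.
rewrite [X in X + _ + _]big1 => [|j _]; last by rewrite zcoordE mul0r.
rewrite [X in _ + X + _]big1 => [|j _]; last by rewrite zcoordE mul0r.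
rewrite !add0r -[RHS](sum_delta i (fun j => (m j)%:R)); apply: eq_bigr => j _.
by rewrite zcoordE eq_sym.
Qed.

Lemma xyz_expo_inj k l m k' l' m' : xyz_expo k l m = xyz_expo k' l' m' ->
  [/\ k = k', l = l' & m = m'].
Proof.
have natrI : injective (fun n : nat => n%:R : int).
  by move=> a b; rewrite /= !natz => -[].
move=> ek; split; apply/mnmP => i; apply: natrI.
- by have := congr1 (xcoord i) ek; rewrite !xyz_expoE.
- by have := congr1 (ycoord i) ek; rewrite !xyz_expoE.
by have := congr1 (zcoord i) ek; rewrite !xyz_expoE.
Qed.

Lemma part_expo_shift la mu nu :
  xyz_expo (mshifted r la) (mshifted p mu) (mshifted q nu)
  = part_expo r p q la mu nu + xyz_expo (mshifted r [::]) (mshifted p [::]) (mshifted q [::]).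
Proof.
apply: expoP => i; rewrite [RHS]raddfD /= !xyz_expoE !mnmE /shifted nth_nil add0n natrD.
- by rewrite /xcoord mxE natz.
- by rewrite /ycoord mxE natz.
by rewrite /zcoord mxE natz.
Qed.

End ExponentCoordinates.

Arguments yzdeg {r p q}.

(** * The integrand as a graded series *)

Section IntegrandFactors.

Variables r p q : nat.
Local Notation E := (expo r p q).
Local Notation D := (@yzdeg r p q : {additive E -> int}).
Local Notation deg := (degree D).

Lemma deg_xv i : deg (xv p q i) = 0. Proof. exact: (@yzdegE r p q).1.1 i. Qed.
Lemma deg_yv a : deg (yv r q a) = 1. Proof. exact: (@yzdegE r p q).1.2 a. Qed.
Lemma deg_zv c : deg (zv r p c) = 1. Proof. exact: (@yzdegE r p q).2 c. Qed.

Definition gkernelK n (u : 'I_n -> E) : gser D :=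
  \prod_(i < r) \prod_(a < n) (ggeom D (xv p q i + u a) * ggeom D (- xv p q i + u a)).

Definition gfactorC : gser D :=
  \prod_(i < r) \prod_(j < r | (i <= j)%N) (1 - gmono D (- xv p q i - xv p q j)).

Definition gfactorA n (u : 'I_n -> E) : gser D :=
  pairprod (fun a b => 1 - gmono D (u a + u b)).

Definition gfactorV n (u : 'I_n -> E) : gser D :=
  pairprod (fun a b => 1 - gmono D (- u a + u b)).

Lemma gcoef_prod (I : Type) (s : seq I) (P : pred I) (F : I -> gser D) :
  gcoef (\prod_(i <- s | P i) F i) = \big[@smul E/smono 0]_(i <- s | P i) gcoef (F i).
Proof. exact: (big_morph (@gcoef E D) (id1 := smono 0) (op1 := @smul E)). Qed.

Lemma gcoef_kernelK n (u : 'I_n -> E) : (forall a, deg (u a) = 1) ->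
  gcoef (gkernelK u) = kernelK u.
Proof.
move=> u1; rewrite gcoef_prod; apply: eq_bigr => i _; rewrite gcoef_prod.
apply: eq_bigr => a _; rewrite gcoefM !gcoef_geom // degreeD ?degreeN deg_xv u1;
by rewrite ?oppr0 add0r.
Qed.

Lemma gcoef_factorC : gcoef gfactorC = @factorC r p q.
Proof.
rewrite gcoef_prod; apply: eq_bigr => i _; rewrite gcoef_prod.
by apply: eq_bigr => j _; rewrite gcoef_one_minus // degreeB degreeN !deg_xv oppr0 addr0.
Qed.

Lemma gcoef_factorA n (u : 'I_n -> E) : (forall a, deg (u a) = 1) ->
  gcoef (gfactorA u) = factorA u.
Proof.
move=> u1; rewrite gcoef_prod; apply: eq_bigr => a _; rewrite gcoef_prod.
by apply: eq_bigr => b _; rewrite gcoef_one_minus // degreeD !u1.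
Qed.

Lemma gcoef_factorV n (u : 'I_n -> E) c : (forall a, deg (u a) = c) ->
  gcoef (gfactorV u) = factorV u.
Proof.
move=> u1; rewrite gcoef_prod; apply: eq_bigr => a _; rewrite gcoef_prod.
by apply: eq_bigr => b _; rewrite gcoef_one_minus // degreeD degreeN !u1 addNr.
Qed.

Definition gintegrand : gser D :=
  gkernelK (@yv r p q) * gkernelK (@zv r p q)
    * gfactorA (@yv r p q) * gfactorA (@zv r p q) * gfactorC
    * gfactorV (@xv r p q) * gfactorV (@yv r p q) * gfactorV (@zv r p q).

Lemma gcoef_integrand : gcoef gintegrand = integrand r p q.
Proof.
rewrite /gintegrand /integrand !gcoefM.
rewrite (gcoef_kernelK deg_yv) (gcoef_kernelK deg_zv) (gcoef_factorA deg_yv).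
rewrite (gcoef_factorA deg_zv) gcoef_factorC (gcoef_factorV deg_xv).
by rewrite (gcoef_factorV deg_yv) (gcoef_factorV deg_zv).
Qed.

End IntegrandFactors.

Lemma pairprod_split (R : comNzRingType) p q (F : 'I_(p + q) -> 'I_(p + q) -> R) :
  pairprod F = pairprod (fun a b => F (lshift q a) (lshift q b))
    * pairprod (fun c d => F (rshift p c) (rshift p d))
    * \prod_(a < p) \prod_(c < q) F (lshift q a) (rshift p c).
Proof.
rewrite /pairprod big_split_ord /= mulrAC; congr (_ * _).
  rewrite -big_split; apply: eq_bigr => a _; rewrite big_mkcond big_split_ord /=.
  rewrite -big_mkcond; congr (_ * _); apply: eq_bigr => c _.
  by rewrite ltn_addr.
apply: eq_bigr => c _; rewrite big_mkcond big_split_ord /= big1 ?mul1r.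
  by rewrite -big_mkcond; apply: eq_bigl => d; rewrite ltn_add2l.
by move=> a _; rewrite ltnNge (ltnW (ltn_addr _ _)).
Qed.

Lemma mulr_sum3 (R : comNzRingType) (I : Type) (s : seq I) (F G H : I -> R) t :
  (\sum_(i <- s) F i) * ((\sum_(j <- s) G j) * ((\sum_(k <- s) H k) * t))
  = \sum_(i <- s) \sum_(j <- s) \sum_(k <- s) F i * (G j * (H k * t)).
Proof.
rewrite mulr_suml; apply: eq_bigr => i _; rewrite mulr_suml mulr_sumr.
by apply: eq_bigr => j _; rewrite mulr_suml !mulr_sumr.
Qed.

(** * The coefficient formula *)

Section CoefficientFormula.

Variables p q : nat.
Local Notation r := (p + q)%N.
Local Notation E := (expo r p q).
Local Notation D := (@yzdeg r p q : {additive E -> int}).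
Local Notation deg := (degree D).
Local Notation x := (@xv r p q).
Local Notation y := (@yv r p q).
Local Notation z := (@zv r p q).
Local Notation g := (gmono D).

Definition yzv (j : 'I_r) : E :=
  match split j with inl a => y a | inr c => z c end.

Let xi (k : 'I_r) : {additive E -> int} := @xcoord r p q k.

Lemma yzv_lshift a : yzv (lshift q a) = y a.
Proof. by rewrite /yzv (unsplitK (inl a)). Qed.

Lemma yzv_rshift c : yzv (rshift p c) = z c.
Proof. by rewrite /yzv (unsplitK (inr c)). Qed.

Fact deg_yzv j : deg (yzv j) = 1.
Proof. by rewrite /yzv; case: split => ?; rewrite ?deg_yv ?deg_zv. Qed.

Fact xi_xv k i : degree (xi k) (x i) = (k == i)%:R.
Proof. exact: (@xcoordE r p q).1.1. Qed.

Fact xi_yv k a : degree (xi k) (y a) = 0.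
Proof. exact: (@xcoordE r p q).1.2. Qed.

Fact xi_zv k c : degree (xi k) (z c) = 0.
Proof. exact: (@xcoordE r p q).2. Qed.

Fact xi_yzv k j : degree (xi k) (yzv j) = 0.
Proof. by rewrite /yzv; case: split => ?; rewrite ?xi_yv ?xi_zv. Qed.

Fact yzv_free (i j : 'I_r) k : (i < j)%N -> (yzv j - yzv i) *+ k = 0 -> k = 0%N.
Proof.
move=> ltij; have nij : i != j by rewrite -val_eqE ltn_eqF.
have [f fj fi] : exists2 f : {additive E -> int}, f (yzv j) = 1 & f (yzv i) = 0.
  rewrite -(splitK j) -(splitK i) in nij *.
  case: (split j) nij => b /=; case: (split i) => a /=;
    rewrite ?yzv_lshift ?yzv_rshift => nij.
  - exists (@ycoord r p q b) => /=; rewrite ycoordE ?eqxx //.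
    by have [eab|//] := eqVneq b a; rewrite eab eqxx in nij.
  - by exists (@ycoord r p q b) => /=; rewrite ycoordE ?eqxx.
  - by exists (@zcoord r p q b) => /=; rewrite zcoordE ?eqxx.
  exists (@zcoord r p q b) => /=; rewrite zcoordE ?eqxx //.
  by have [eab|//] := eqVneq b a; rewrite eab eqxx in nij.
move/(congr1 f); rewrite raddfMn raddfB fj fi subr0 raddf0 natz.
by case.
Qed.

Let Pyz : gser D := \prod_a \prod_c ggeom D (y a + z c).
Let Pxy : gser D := \prod_i \prod_a ggeom D (x i + y a).
Let Pxz : gser D := \prod_i \prod_c ggeom D (x i + z c).
Let alt_of n (h : 'I_n -> E) : gser D := alt (fun i => g (h i)) (shifted n [::]).

Lemma symplectic_kernel_split : symplectic_kernel D x yzv =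
  gkernelK y * gkernelK z * (gfactorA y * gfactorA z
    * \prod_a \prod_c (1 - g (y a) * g (z c))) * gfactorC r p q.
Proof.
rewrite /symplectic_kernel.
have -> : \prod_i \prod_j (ggeom D (x i + yzv j) * ggeom D (- x i + yzv j))
    = gkernelK y * gkernelK z.
  rewrite /gkernelK -big_split; apply: eq_bigr => i _.
  rewrite big_split_ord /=; congr (_ * _); apply: eq_bigr => a _.
    by rewrite yzv_lshift.
  by rewrite yzv_rshift.
have -> : pairprod (fun i j => 1 - g (yzv i) * g (yzv j))
   = gfactorA y * gfactorA z * \prod_a \prod_c (1 - g (y a) * g (z c)).
  rewrite pairprod_split.
  have -> : gfactorA y = pairprod (fun a b => 1 - g (yzv (lshift q a)) * g (yzv (lshift q b))).
    by apply: eq_pairprod => a b _; rewrite !yzv_lshift gmonoD ?deg_yv.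
  have -> : gfactorA z = pairprod (fun a b => 1 - g (yzv (rshift p a)) * g (yzv (rshift p b))).
    by apply: eq_pairprod => a b _; rewrite !yzv_rshift gmonoD ?deg_zv.
  congr (_ * _); apply: eq_bigr => a _; apply: eq_bigr => c _.
  by rewrite yzv_lshift yzv_rshift.
have -> : gfactorC r p q
    = \prod_(i < r) \prod_(j < r | (i <= j)%N) (1 - g (- x i) * g (- x j)).
  rewrite /gfactorC; apply: eq_bigr => i _; apply: eq_bigr => j _.
  by rewrite gmonoD ?degreeN ?deg_xv ?oppr0.
by [].
Qed.

Lemma cauchy_kernel_split : cauchy_kernel D x yzv = Pxy * Pxz.
Proof.
rewrite -big_split; apply: eq_bigr => i _; rewrite big_split_ord /=; congr (_ * _).
  by apply: eq_bigr => a _; rewrite yzv_lshift.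
by apply: eq_bigr => c _; rewrite yzv_rshift.
Qed.

Fact PyzK : \prod_a \prod_c (1 - g (y a) * g (z c)) * Pyz = 1.
Proof.
rewrite /Pyz -big_split big1 // => a _; rewrite -big_split big1 // => c _ /=.
by rewrite -gmonoD ?deg_yv ?deg_zv // ggeomK // degreeD deg_yv deg_zv.
Qed.

Let rho : E := xyz_expo (mshifted r [::]) (mshifted p [::]) (mshifted q [::]).

(** The monomial turns the three V into alternants. The factors 1 - y_a z_c, present in A(u) but not
    in the integrand, are compensated by their inverse [Pyz]. *)
Lemma gmono_rho_integrand : g rho * gintegrand r p q
  = symplectic_kernel D x yzv * Pyz * (alt_of x * alt_of y * alt_of z).
Proof.
have bE n (h : 'I_n -> E) : block_expo h (mshifted n [::]) = \sum_i h i *+ (n.-1 - i).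
  by apply: eq_bigr => i _; rewrite mnmE /shifted nth_nil.
have dE n (h : 'I_n -> E) c : 0 <= c -> (forall i, deg (h i) = c) ->
    0 <= deg (block_expo h (mshifted n [::])).
  move=> c0 hc; rewrite /degree raddf_sum; apply: sumr_ge0 => i _.
  by rewrite -/(degree D _) degreeMn hc mulr_ge0.
have dx := dE _ _ _ (lexx 0) (@deg_xv r p q).
have dy := dE _ _ _ ler01 (@deg_yv r p q).
have dz := dE _ _ _ ler01 (@deg_zv r p q).
have dxy : 0 <= deg (block_expo x (mshifted r [::]) + block_expo y (mshifted p [::])).
  by rewrite degreeD; exact: addr_ge0 dx dy.
rewrite /rho /xyz_expo (gmonoD dxy dz) (gmonoD dx dy) !bE.
rewrite /alt_of -(mulr_gmono_pairprod (lexx 0) (@deg_xv r p q)).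
rewrite -(mulr_gmono_pairprod ler01 (@deg_yv r p q)).
rewrite -(mulr_gmono_pairprod ler01 (@deg_zv r p q)).
rewrite symplectic_kernel_split -!/(gfactorV _) /gintegrand.
set T := \prod_a \prod_c _; have TP : T * Pyz = 1 := PyzK.
by rewrite -[LHS]mulr1 -TP; ring.
Qed.

Fact x_degree0_mono k e : degree (xi k) e = 0 -> x_degree0 xi k (g e).
Proof. by move=> ke d /=; case: ifP; rewrite ?eqxx // => _; have [->|] := eqVneq d e. Qed.

Fact x_degree0B k (f h : gser D) : x_degree0 xi k f -> x_degree0 xi k h ->
  x_degree0 xi k (f - h).
Proof.
move=> f0 h0 d; rewrite gcoefB; have [->|/f0 //] := eqVneq (f d) 0.
by rewrite sub0r oppr_eq0; apply: h0.
Qed.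

Fact x_degree0_prod k (I : Type) (s : seq I) (P : pred I) (F : I -> gser D) :
  (forall i, P i -> x_degree0 xi k (F i)) -> x_degree0 xi k (\prod_(i <- s | P i) F i).
Proof.
move=> F0; apply: big_ind => //; last exact: x_degree0M.
by rewrite -(gmono0 D); apply: x_degree0_mono; rewrite degree0.
Qed.

Fact x_degree0_alt k n (h : 'I_n -> E) : (forall i, degree (xi k) (h i) = 0) ->
  x_degree0 xi k (alt_of h).
Proof.
move=> h0; rewrite /alt_of alt_rho_pairprod; apply: x_degree0_prod => i _.
apply: x_degree0_prod => j _.
by apply: x_degree0B; apply: x_degree0_mono.
Qed.

Lemma coef_integrand_cauchy Z : x_nonneg xi (Z + rho) ->
  integrand r p q Z
  = (Pxy * Pxz * Pyz * (alt_of x * alt_of y * alt_of z)) (Z + rho).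
Proof.
move=> ZP; have rho0 : 0 <= deg rho.
  rewrite /degree /rho /= /yzdeg.
  by apply: addr_ge0; apply: sumr_ge0 => i _; rewrite xyz_expoE.
rewrite -gcoef_integrand.
have -> : gintegrand r p q Z = (g rho * gintegrand r p q) (Z + rho).
  by rewrite gcoef_monoM // addrK.
rewrite gmono_rho_integrand; apply/eqP; rewrite -subr_eq0 -gcoefB; apply/eqP.
have V := symplectic_kernelP (@deg_xv r p q) deg_yzv xi_xv xi_yzv yzv_free.
(* The sign between the two orders of subtraction in the Vandermonde product of x. *)
pose s : gser D := pairprod (fun i j : 'I_r => -1).
have altx : alt_of x = pairprod (fun i j => g (x j) - g (x i)) * s.
  rewrite /alt_of alt_rho_pairprod -pairprodM; apply: eq_pairprod => i j _.
  by rewrite mulrN1 opprB.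
have -> : symplectic_kernel D x yzv * Pyz * (alt_of x * alt_of y * alt_of z)
   - Pxy * Pxz * Pyz * (alt_of x * alt_of y * alt_of z)
   = (symplectic_kernel D x yzv - cauchy_kernel D x yzv)
       * pairprod (fun i j => g (x j) - g (x i)) * (s * Pyz * alt_of y * alt_of z).
  by rewrite cauchy_kernel_split altx; ring.
apply: (x_vanishingM V) => // k.
have s0 : x_degree0 xi k s.
  apply: x_degree0_prod => i _; apply: x_degree0_prod => j _.
  rewrite -sub0r; apply: x_degree0B; first by move=> d; rewrite gcoef0 eqxx.
  by rewrite -(gmono0 D); apply: x_degree0_mono; rewrite degree0.
have Pyz0 : x_degree0 xi k Pyz.
  apply: x_degree0_prod => a _; apply: x_degree0_prod => c _ d.
  rewrite gcoef_geom ?degreeD ?deg_yv ?deg_zv // => /geom_neq0[t ->].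
  by rewrite degreeMn degreeD xi_yv xi_zv mul0r.
have y0 := x_degree0_alt (xi_yv k); have z0 := x_degree0_alt (xi_zv k).
exact: x_degree0M (x_degree0M (x_degree0M s0 Pyz0) y0) z0.
Qed.

Section Truncation.

Variable B : nat.
Hypotheses (leB : (r <= B)%N).

Let S n (h : 'I_n -> E) la : gser D := block_eval D h (svar n la).

Lemma cauchy_block n n' (h : 'I_n -> E) (h' : 'I_n' -> E) :
    (forall i, 0 <= deg (h i)) -> (forall j, 1 <= deg (h' j)) -> (n <= B)%N ->
  gcongr B%:Z (\prod_i \prod_j ggeom D (h i + h' j) * alt_of h)
    ((\sum_(la <- boxed_parts B) S h la * S h' la) * alt_of h).
Proof.
move=> h0 h'1 len.
have h'P e : e \in codom h' -> 1 <= deg e by case/codomP => j ->; apply: h'1.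
have -> : \prod_i \prod_j ggeom D (h i + h' j)
    = \prod_i \prod_(e <- codom h') ggeom D (h i + e).
  by apply: eq_bigr => i _; rewrite big_image.
have -> : \sum_(la <- boxed_parts B) S h la * S h' la
    = \sum_(la <- boxed_parts B) spoly (codom (fun i => g (h i))) la
                               * spoly (map g (codom h')) la.
  by apply: eq_bigr => la _; rewrite /S !block_eval_svar [in RHS]/codom -map_comp.
exact: cauchy_identity.
Qed.

(** A single a_rho(x) serves both identities in x, one after the other; a_rho(y) serves the one in y
    and z, and a_rho(z) is carried along. *)
Lemma cauchy_product_expand :
  gcongr B%:Z (Pxy * Pxz * Pyz * (alt_of x * alt_of y * alt_of z))
    (\sum_(al <- boxed_parts B) \sum_(be <- boxed_parts B) \sum_(ga <- boxed_parts B)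
       block_eval D x (svar r be * svar r ga * rho_alt r)
       * block_eval D y (svar p al * svar p be * rho_alt p)
       * block_eval D z (svar q al * svar q ga * rho_alt q)).
Proof.
have x0 i : 0 <= deg (x i) by rewrite deg_xv.
have y1 a : 1 <= deg (y a) by rewrite deg_yv.
have z1 c : 1 <= deg (z c) by rewrite deg_zv.
have y0 a : 0 <= deg (y a) by rewrite deg_yv.
have Cxy := cauchy_block x0 y1 leB; have Cxz := cauchy_block x0 z1 leB.
have Cyz := cauchy_block y0 z1 (leq_trans (leq_addr q p) leB).
set Sxy := (\sum_(la <- _) _) in Cxy; set Sxz := (\sum_(la <- _) _) in Cxz.
set Syz := (\sum_(la <- _) _) in Cyz.
have -> : \sum_(al <- boxed_parts B) \sum_(be <- boxed_parts B) \sum_(ga <- boxed_parts B)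
       block_eval D x (svar r be * svar r ga * rho_alt r)
       * block_eval D y (svar p al * svar p be * rho_alt p)
       * block_eval D z (svar q al * svar q ga * rho_alt q)
   = Sxy * (Sxz * alt_of x) * (Syz * alt_of y) * alt_of z.
  have -> : Sxy * (Sxz * alt_of x) * (Syz * alt_of y) * alt_of z
    = Syz * (Sxy * (Sxz * (alt_of x * alt_of y * alt_of z))) by ring.
  rewrite mulr_sum3; apply: eq_bigr => al _; apply: eq_bigr => be _.
  apply: eq_bigr => ga _.
  by rewrite !rmorphM /= !block_eval_rho_alt /alt_of /S; ring.
have -> : Pxy * Pxz * Pyz * (alt_of x * alt_of y * alt_of z)
  = Pxz * (Pxy * alt_of x) * (Pyz * alt_of y) * alt_of z by ring.
apply: gcongrM; last exact: gcongr_refl.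
apply: gcongrM; last exact: Cyz.
apply: (gcongr_trans (g := Pxz * (Sxy * alt_of x))).
  by apply: gcongrM; [exact: gcongr_refl | exact: Cxy].
rewrite mulrCA; apply: gcongrM; [exact: gcongr_refl | exact: Cxz].
Qed.

End Truncation.

(** A nonzero summand has |mu| = |al| + |be| and |nu| = |al| + |ga|, which bounds all three
    indices. *)
Lemma NL_seq (Q : seq intpart) (mu nu la : intpart) : uniq Q ->
    (forall ka : intpart, (sumn ka <= sumn mu + sumn nu)%N -> ka \in Q) ->
  NL mu nu la = \sum_(al <- Q) \sum_(be <- Q) \sum_(ga <- Q)
    LR al be mu * LR al ga nu * LR be ga la.
Proof.
move=> Quniq QP; pose T := [seq (ab, c) | ab <- [seq (a, b) | a <- Q, b <- Q], c <- Q].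
rewrite /NL (@fsum_seq _ _ T).
- by rewrite !big_allpairs_dep.
- by apply: allpairs_uniq => // [|[? ?] [? ?]] //; apply: allpairs_uniq => // [[? ?] [? ?]].
case=> -[al be] ga; rewrite !mulf_eq0 !negb_or.
case/andP=> /andP[/LR_neq0_sumn emu /LR_neq0_sumn enu] _.
apply/allpairsP; exists ((al, be), ga); split=> //=; last by apply: QP; lia.
by apply/allpairsP; exists (al, be); split=> //=; apply: QP; lia.
Qed.

(** The lengths are only bounded, so that the formula also covers the empty partitions obtained by
    scaling with t = 0. *)
Lemma NL_coefficient (la mu nu : intpart) :
  (size la <= r)%N -> (size mu <= p)%N -> (size nu <= q)%N ->
  NL mu nu la = integrand r p q (part_expo r p q la mu nu).
Proof.
move=> lela lemu lenu; set Z := part_expo r p q la mu nu.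
have ZE : Z + rho = xyz_expo (mshifted r la) (mshifted p mu) (mshifted q nu).
  by rewrite part_expo_shift.
rewrite coef_integrand_cauchy; last first.
  by move=> k; rewrite ZE /degree /= xyz_expoE.
(* The summands serve, in turn, the condition r <= B, a truncation beyond the degree of the
   coefficient, and a range covering all indices of [NL]. *)
pose B := (r + `|deg (Z + rho)|.+1 + (sumn mu + sumn nu))%N.
have leB : (r <= B)%N by rewrite /B; lia.
rewrite (gcongr_coef (cauchy_product_expand leB)); last by rewrite /B; lia.
rewrite (@NL_seq (boxed_parts B)) ?uniq_boxed_parts //; last first.
  by move=> ka leka; apply: mem_boxed_parts_sumn; rewrite /B; lia.
rewrite gcoef_sum; apply: eq_bigr => al _; rewrite gcoef_sum; apply: eq_bigr => be _.
rewrite gcoef_sum; apply: eq_bigr => ga _.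
rewrite ZE /xyz_expo coef_block_evalM3; first last.
- by move=> *; apply: xyz_expo_inj.
- by move=> c; rewrite deg_zv.
- by move=> a; rewrite deg_yv.
- by move=> i; rewrite deg_xv.
rewrite (LR_prod_coef _ _ lela) (LR_prod_coef _ _ lemu) (LR_prod_coef _ _ lenu).
by rewrite mulrC mulrA.
Qed.

End CoefficientFormula.

(** * Scaling and the generating function *)

Lemma nth_scale_seq t (la : intpart) j :
  nth 0%N (scale_seq t la) j = (t * nth 0%N la j)%N.
Proof.
rewrite /scale_seq nth_filter_neq0.
  have [ltj|lej] := ltnP j (size la); first by rewrite (nth_map 0%N).
  by rewrite !nth_default ?size_map ?muln0.
apply: homo_sorted (intpart_sorted la) => a b /= leab.
by rewrite leq_mul2l leab orbT.
Qed.

Lemma size_scale_seq t (la : seq nat) : (size (scale_seq t la) <= size la)%N.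
Proof.
rewrite /scale_seq size_filter; apply: leq_trans (count_size _ _) _.
by rewrite size_map.
Qed.

Lemma part_expo_scale r p q t (la mu nu : intpart) :
  part_expo r p q (scale_seq t la) (scale_seq t mu) (scale_seq t nu)
  = part_expo r p q la mu nu *+ t.
Proof.
apply: expoP => i; rewrite raddfMn /=;
  rewrite ?/(xcoord _ _) ?/(ycoord _ _) ?/(zcoord _ _) !mxE nth_scale_seq;
  by rewrite PoszM mulrC -mulr_natr natz.
Qed.

Lemma wconst_term_wgeom (E : zmodType) (f : series E) d t :
  wconst_term (wscale f (wgeom (- d))) t = f (d *+ t).
Proof.
rewrite /wconst_term /wscale /wgeom /smul /smono (@fsum_seq _ _ [:: d *+ t]) //.
  by rewrite big_seq1 sub0r mulNrn eqxx mulr1.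
move=> e; rewrite sub0r mulNrn (inj_eq oppr_inj) inE.
by have [//|_] := eqVneq e (d *+ t); rewrite mulr0 eqxx.
Qed.

Theorem theorem3p1 (lambda mu nu : intpart) (m p q r : nat)
    (hm : size lambda = m) (hp : size mu = p) (hq : size nu = q)
    (hmpq : (m <= p + q)%N) (hr : r = (p + q)%N) :
  let Z : expo r p q := part_expo r p q lambda mu nu in
  NL mu nu lambda = integrand r p q Z
  /\ (forall t : nat,
        NL (scale_part t mu) (scale_part t nu) (scale_part t lambda)
        = wconst_term (wscale (integrand r p q) (wgeom (- Z))) t).
Proof.
move=> Z; rewrite {}/Z; subst m p q r; split; first exact: NL_coefficient.
move=> t; rewrite wconst_term_wgeom -part_expo_scale.
by apply: NL_coefficient; apply: leq_trans (size_scale_seq _ _) _.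
Qed.
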